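(* Let $Z<0$, $N\ge2$, $p>1$ and fix $n\in\{1,\dots,N-1\}$, and let $\omega_{n,p}^*=\dfrac{\big(\alpha_{n,p}(t_{n,p}^* )\big)^2}{Z^2}$. Then for every $\omega>\omega_{n,p}^*$ there exist two shifts $0<a_A(\omega)<a_*^{(p)}<a_B(\omega)$ such that the stationary profile $\Theta_{\omega,n}=(\Psi_{a_1},\dots,\Psi_{a_N})$, carrying $a_1$ on the first $n$ edges and $a_N$ on the remaining $N-n$, belongs to $D(\mathcal H_Z^{\delta'})$. Moreover $$(\omega_{n,p}^*,\infty)\ni\omega\longmapsto e^{it\omega}\Theta_{\omega,n}\in D(\mathcal H_Z^{\delta'})$$ is a smooth curve of standing waves for the nonlinear Schrödinger equation with power $p$ on $\mathcal G$, discontinuous at the vertex.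
   Context: Star graph: $\mathcal G$ consists of $N$ half-lines, each identified with $[L,\infty)$, $L\ge0$, joined at the common vertex $x=L$. Functions on $\mathcal G$ are $N$-tuples $\mathbf U=(\psi_j)_{j=1}^N$; $H^2(\mathcal G)=\bigoplus_{j=1}^N H^2(L,\infty)$. The operator $\mathcal H_Z^{\delta'}$ acts as $(\psi_j)_j\mapsto(-\psi_j'')_j$ on $$D(\mathcal H_Z^{\delta'})=\Big\{\mathbf U\in H^2(\mathcal G):\ \psi_1'(L)=\dots=\psi_N'(L),\ \sum_{j=1}^N\psi_j(L)=Z\psi_1'(L)\Big\}.$$ NLS: $i\mathbf U_t-\mathcal H_Z^{\delta'}\mathbf U+|\mathbf U|^{p-1}\mathbf U=\mathbf 0$; a standing wave is a solution of the form $e^{i\omega t}\Theta(x)$ with $\Theta\in D(\mathcal H_Z^{\delta'})$. A function is discontinuous at the vertex if $\psi_1(L)=\dots=\psi_N(L)$ fails. Profiles: for $\omega>0$ and a shift $a>0$, $$\Psi_a(x)=\Big(\tfrac{(p+1)\omega}{2}\Big)^{1/(p-1)}\operatorname{sech}^{2/(p-1)}\Big(\tfrac{p-1}{2}\sqrt\omega\,(x-L)+a\Big),\qquad x\ge L,$$ a positive decaying solution of $-\Psi''+\omega\Psi-\Psi^p=0$. In $\Theta_{\omega,n}$ one has $a_1=\dots=a_n$, $a_{n+1}=\dots=a_N$, with $a_1,a_N\in\{a_A(\omega),a_B(\omega)\}$ and $a_1\ne a_N$. Branch data: $t_p^*=\sqrt{\frac{p-1}{p+1}}$ and $a_*^{(p)}=\operatorname{arctanh}(t_p^*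 )$. Let $h(t)=t^{p-1}(1-t^2)$ on $(0,1)$ (with maximum at $t_p^*$), and let $\xi_p$ be the involution of $(0,1)$ determined by $h(\xi_p(t))=h(t)$ with $\xi_p(t)\in[t_p^*,1)$ for $t\in(0,t_p^*]$ and $\xi_p(t)\in(0,t_p^*]$ for $t\in[t_p^*,1)$. Let $$\alpha_{n,p}(t)=\frac nt+\frac{N-n}{\xi_p(t)},\qquad t\in(0,1),$$ which tends to $+\infty$ as $t\to0^+$ and as $t\to1^-$. Here $t_{n,p}^*\in(0,1)$ denotes an interior minimizer of $\alpha_{n,p}$ (not claimed to be unique, nor necessarily the point where the infimum over $(0,1)$ is attained) giving a decreasing branch $(0,t_{n,p}^* )$ of $\alpha_{n,p}$, on which $t_1(\omega)=\tanh(a_1)\in(0,t_{n,p}^* )$ solves $\alpha_{n,p}(t_1(\omega))=-Z\sqrt\omega$ for $\omega>\omega_{n,p}^*$, with $\tanh(a_N)=\xi_p(t_1(\omega))$.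
   Formalization: If n > N/2 the decreasing branch (0,t* ) passes through t_p^*, where a_1 = a_N and the profile is continuous; so the claim is proved with tanh(a_1) not required in (0,t* ), and on (0,t* ) the shift order, discontinuity and smoothness are proved except where tanh(a_1) = t_p^*. *)

(* Defs.v *)
From HB Require Import structures.
From mathcomp Require Import all_boot all_order all_algebra.
From mathcomp Require Import complex.
From mathcomp Require Import all_classical all_reals all_analysis.

Set Implicit Arguments.
Unset Strict Implicit.
Unset Printing Implicit Defensive.

Import Order.TTheory GRing.Theory Num.Theory.
Import numFieldNormedType.Exports.

Local Open Scope classical_set_scope.
Local Open Scope complex_scope.
Local Open Scope ring_scope.

Section Hyperbolic.
Context {R : realType}.

Definition sech (x : R) : R := 2 / (expR x + expR (- x)).
Definition tanh (x : R) : R := (expR x - expR (- x)) / (expR x + expR (- x)).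
Definition artanh (t : R) : R := ln ((1 + t) / (1 - t)) / 2.
Definition expi (theta : R) : R[i] := cos theta +i* sin theta.
Definition cmod (z : R[i]) : R := ComplexField.Normc.normc z.

End Hyperbolic.

Section StarGraph.
Context {R : realType} {N : nat}.
Local Notation mu := (@lebesgue_measure R).

(* A function on the star graph is one complex function per edge.  Each edge
   function is total on R, but only its values on [L, +oo[ are ever used. *)
Definition graph_fun := 'I_N -> R -> R[i].

Definition sqint (L : R) (f : R -> R[i]) : \bar R :=
  \int[mu]_(x in `[L, +oo[) ((cmod (f x)) ^+ 2)%:E.

Definition L2_edge (L : R) (f : R -> R[i]) : Prop :=
  [/\ measurable_fun `[L, +oo[ (fun x => complex.Re (f x)),
      measurable_fun `[L, +oo[ (fun x => complex.Im (f x)) &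
      (sqint L f < +oo)%E].

(* f is the (locally absolutely continuous) primitive of g on [L, +oo[. *)
Definition AC_deriv (L : R) (f g : R -> R[i]) : Prop :=
  forall x, L <= x ->
    complex.Re (f x) - complex.Re (f L) =
      \int[mu]_(y in `[L, x]) complex.Re (g y) /\
    complex.Im (f x) - complex.Im (f L) =
      \int[mu]_(y in `[L, x]) complex.Im (g y).

(* f belongs to H^2(L, +oo), with first and second weak derivatives f1 and f2.
   f and f1 are the continuous representatives, so f L and f1 L are the traces;
   f2 is only determined almost everywhere. *)
Definition H2_edge (L : R) (f f1 f2 : R -> R[i]) : Prop :=
  [/\ L2_edge L f, L2_edge L f1, L2_edge L f2,
      AC_deriv L f f1 & AC_deriv L f1 f2].

Definition L2_sqnorm (L : R) (U : graph_fun) : \bar R :=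
  (\sum_(j < N) sqint L (U j))%E.

(* The squared H^2(G)-norm of U, U1 and U2 being its first two derivatives. *)
Definition H2_sqnorm (L : R) (U U1 U2 : graph_fun) : \bar R :=
  (L2_sqnorm L U + L2_sqnorm L U1 + L2_sqnorm L U2)%E.

Definition delta'_dom_with (Z L : R) (U U1 U2 : graph_fun) : Prop :=
  [/\ forall j, H2_edge L (U j) (U1 j) (U2 j),
      forall j k, U1 j L = U1 k L &
      forall j, \sum_(k < N) U k L = Z%:C * U1 j L].

Definition delta'_dom (Z L : R) (U : graph_fun) : Prop :=
  exists U1 U2, delta'_dom_with Z L U U1 U2.

(* The action of the operator, in terms of the second derivative. *)
Definition delta'_op (U2 : graph_fun) : graph_fun := fun j x => - U2 j x.

Definition fsub (U V : graph_fun) : graph_fun := fun j x => U j x - V j x.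

(* (F (s + h) - F s) / h - V, the error of V as a derivative of F at s. *)
Definition quot_err (F : R -> graph_fun) (V : graph_fun) (s h : R) :
  graph_fun := fun j x => (h^-1)%:C * (F (s + h) j x - F s j x) - V j x.

(* Solutions, global in time, of  i U_t - H U + |U|^(p-1) U = 0  in the class
   C(R; D(H)) with U_t the derivative of U in L^2(G); the equation then puts
   U in C^1(R; L^2(G)). *)
Definition NLS_solution (p Z L : R) (U : R -> graph_fun) : Prop :=
  exists U1 U2 V : R -> graph_fun,
  [/\ forall t, delta'_dom_with Z L (U t) (U1 t) (U2 t),
      forall t, H2_sqnorm L (fsub (U s) (U t)) (fsub (U1 s) (U1 t))
                  (fsub (U2 s) (U2 t)) @[s --> t] --> 0%E,
      forall t, (forall j, L2_edge L (V t j)) /\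
                L2_sqnorm L (quot_err U (V t) t h) @[h --> 0^'] --> 0%E &
      forall t j, {ae mu, forall x, L <= x ->
        (0 +i* 1) * V t j x - delta'_op (U2 t) j x
          + ((cmod (U t j x)) `^ (p - 1))%:C * U t j x = 0}].

Definition phase (theta : R) (U : graph_fun) : graph_fun :=
  fun j x => expi theta * U j x.

Definition standing_wave (p Z L om : R) (U : graph_fun) : Prop :=
  delta'_dom Z L U /\ NLS_solution p Z L (fun t => phase (om * t) U).

(* c restricted to the open set J is a C^oo curve in the domain of the operator
   equipped with the H^2(G)-norm; G k is its k-th derivative. *)
Definition smooth_curve (Z L : R) (J : set R) (c : R -> graph_fun) : Prop :=
  exists G G1 G2 : nat -> R -> graph_fun,
  (forall om, J om -> G 0%N om = c om) /\
  forall k om, J om ->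
    delta'_dom_with Z L (G k om) (G1 k om) (G2 k om) /\
    H2_sqnorm L (quot_err (G k) (G k.+1 om) om h)
      (quot_err (G1 k) (G1 k.+1 om) om h)
      (quot_err (G2 k) (G2 k.+1 om) om h) @[h --> 0^'] --> 0%E.

Definition vertex_discontinuous (L : R) (U : graph_fun) : Prop :=
  ~ (forall j k, U j L = U k L).

End StarGraph.

Arguments graph_fun : clear implicits.

Section Branch.
Context {R : realType}.

Definition tcrit (p : R) : R := Num.sqrt ((p - 1) / (p + 1)).
Definition acrit (p : R) : R := artanh (tcrit p).
Definition hfun (p t : R) : R := t `^ (p - 1) * (1 - t ^+ 2).

(* For p > 1 and 0 < t < 1 there is exactly one s satisfying these conditions. *)
Definition xi (p t : R) : R :=
  xget 0 [set s | [/\ 0 < s < 1, hfun p s = hfun p t,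
                      t <= tcrit p -> tcrit p <= s &
                      tcrit p <= t -> s <= tcrit p]].

Definition alpha (N n : nat) (p t : R) : R :=
  n%:R / t + (N - n)%:R / xi p t.

(* t is an interior (local) minimizer closing the decreasing branch ]0, t[.
   When N < 2 n it exceeds tcrit p, and the branch then runs through the point
   tcrit p, where xi p t = t and the profile is continuous at the vertex. *)
Definition decreasing_branch_end (N n : nat) (p t : R) : Prop :=
  [/\ 0 < t < 1,
      forall r s, 0 < r -> r < s -> s < t -> alpha N n p s < alpha N n p r &
      \forall s \near t, alpha N n p t <= alpha N n p s].

Definition Psi (p L om a x : R) : R :=
  ((p + 1) * om / 2) `^ (p - 1)^-1 *
  (sech ((p - 1) / 2 * Num.sqrt om * (x - L) + a)) `^ (2 / (p - 1)).

Definition Theta (N n : nat) (p L om a1 aN : R) : graph_fun R N :=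
  fun j x => (Psi p L om (if (j < n)%N then a1 else aN) x)%:C.

Definition branch_eq (N n : nat) (p Z om a1 aN : R) : Prop :=
  alpha N n p (tanh a1) = - Z * Num.sqrt om /\ tanh aN = xi p (tanh a1).

(* a1 and aN take the two values aA < acrit p < aB, in either order. *)
Definition shift_pair (p a1 aN aA aB : R) : Prop :=
  [/\ 0 < aA, aA < acrit p, acrit p < aB &
      (a1 = aA /\ aN = aB) \/ (a1 = aB /\ aN = aA)].

End Branch.

Arguments Theta {R} N n p L om a1 aN.

(* Main.v *)
Require Import Defs.
From mathcomp Require Import all_boot all_order all_algebra.
From mathcomp Require Import complex zify ring lra.
From mathcomp Require Import all_classical all_reals all_analysis.
From mathcomp Require Import measurable_realfun.
Import Order.TTheory GRing.Theory Num.Theory.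
Import numFieldNormedType.Exports.
Local Open Scope classical_set_scope.
Local Open Scope ring_scope.

Set Implicit Arguments.
Unset Strict Implicit.
Unset Printing Implicit Defensive.

(** Put [d = (p - 1) / 2]. Two distinct points of [(0, 1)] with ratio [e^(- v / 2)]
have the same value of [hfun p] exactly when their squares are
[sigma (- v) = e^(- v) * sigma v] and [sigma v], where
[sigma v = (1 - e^(- d v)) / (1 - e^(- (d + 1) v))]. So [t = sqrt (sigma (- v))]
parametrizes [(0, 1)] by the real line, [xi p t = sqrt (sigma v)], [v = 0] is
[t = tcrit p], and [alpha] becomes
[bF v = n / sqrt (sigma (- v)) + (N - n) / sqrt (sigma v)].

For [v > 0] the derivative of [bF] has the sign of [n * fE v - (N - n) * fA v],
where the exponential sums [fA] and [fE] are positive and [fE / fA] is strictly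
increasing; negative [v] reduce to this by exchanging [n] and [N - n]. Hence a
critical point of [bF] other than [0] cannot lie inside a monotone branch: on the
given decreasing branch of [alpha] the derivative vanishes at most at [v = 0], and
if the branch end lies beyond [tcrit p], then [bF] is strictly monotone with
nonzero derivative on the remaining interval up to [t = 1]. The latter interval
provides the shifts of the first half of the theorem when the given branch runs
through [tcrit p]. In all cases [v] is a smooth function of [om] by the inverse
function theorem.

All derivatives of the profiles, in [x] or in a parameter, have the form
[sech y `^ beta] times a polynomial in [x - L] and [tanh y]. They therefore decay
exponentially, locally uniformly in the parameter, so difference quotients converge
in [H^2] by the mean value inequality. This is applied with parameter [om] for the
curve of standing waves and with parameter [t] for the evolution equation. *)

(** * Differential calculus and smooth functions of one variable *)

Section Derivatives.
Context {R : realType}.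
Implicit Types (f g : R -> R) (x a b k : R) (J I : set R).

Lemma is_derive_cstf k x : is_derive x 1 (fun=> k) 0.
Proof. exact: is_derive_cst. Qed.

Lemma is_derive_idf x : is_derive x 1 (fun y => y) 1.
Proof. exact: is_derive_id. Qed.

Lemma is_derive_addf f g x a b : is_derive x 1 f a -> is_derive x 1 g b ->
  is_derive x 1 (fun y => f y + g y) (a + b).
Proof. exact: is_deriveD. Qed.

Lemma is_derive_oppf f x a : is_derive x 1 f a ->
  is_derive x 1 (fun y => - f y) (- a).
Proof. exact: is_deriveN. Qed.

Lemma is_derive_subf f g x a b : is_derive x 1 f a -> is_derive x 1 g b ->
  is_derive x 1 (fun y => f y - g y) (a - b).
Proof. exact: is_deriveB. Qed.

Lemma is_derive_mulf f g x a b : is_derive x 1 f a -> is_derive x 1 g b ->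
  is_derive x 1 (fun y => f y * g y) (a * g x + f x * b).
Proof.
move=> fa gb; apply: (is_derive_eq (is_deriveM fa gb)).
by rewrite /GRing.scale/= addrC mulrC.
Qed.

Lemma is_derive_compf f g x a b : is_derive (g x) 1 f a -> is_derive x 1 g b ->
  is_derive x 1 (fun y => f (g y)) (a * b).
Proof. exact: is_derive1_comp. Qed.

Lemma is_derive_invf f x a : f x != 0 -> is_derive x 1 f a ->
  is_derive x 1 (fun y => (f y)^-1) (- (a / f x ^+ 2)).
Proof.
move=> fx fa; apply: (is_derive_eq (is_deriveV fx fa)).
by rewrite /GRing.scale/= mulNr mulrC.
Qed.

Lemma is_derive_expf f x a : is_derive x 1 f a ->
  is_derive x 1 (fun y => expR (f y)) (expR (f x) * a).
Proof. by move=> fa; apply: is_derive_compf; exact: is_derive_expR. Qed.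

Lemma is_derive_congr f g x a b : is_derive x 1 f a -> f = g -> a = b ->
  is_derive x 1 g b.
Proof. by move=> fa <- <-. Qed.

Lemma is_derive_eqval f x a b : is_derive x 1 f a -> is_derive x 1 f b -> a = b.
Proof. by move=> [_ <-] [_ <-]. Qed.

Lemma is_derive_derive1 f x a : is_derive x 1 f a -> f^`()%classic x = a.
Proof. by move=> [_ <-]; rewrite derive1E. Qed.

Lemma derivable_is_derive f x : derivable f x 1 ->
  is_derive x 1 f (f^`()%classic x).
Proof. by move=> fx; apply: DeriveDef => //; rewrite derive1E. Qed.

Lemma is_derive_open_ext J f g x a : open J -> J x ->
  (forall y, J y -> f y = g y) -> is_derive x 1 f a -> is_derive x 1 g a.
Proof.
move=> oJ Jx fg; apply: near_eq_is_derive.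
by near=> y; apply: fg; near: y; exact: open_nbhs_nbhs.
Unshelve. all: by end_near. Qed.

Lemma is_derive_continuous f x a : is_derive x 1 f a -> {for x, continuous f}.
Proof. by move=> [fx _]; apply/differentiable_continuous/derivable1_diffP. Qed.

Lemma is_derive_within f (df : R -> R) (A : set R) :
  (forall x, A x -> is_derive x 1 f (df x)) -> {within A, continuous f}.
Proof.
move=> h; apply: continuous_in_subspaceT => x; rewrite inE => Ax.
exact: is_derive_continuous (h x Ax).
Qed.

Lemma incr_of_is_derive f (df : R -> R) a b : a < b ->
  (forall x, a <= x <= b -> is_derive x 1 f (df x)) ->
  (forall x, a < x < b -> 0 < df x) -> f a < f b.
Proof.
move=> ab hd hp.
have [||c] := @MVT R f df a b ab.
- by move=> x; rewrite in_itv/= => /andP[h1 h2]; apply: hd; rewrite !ltW.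
- by apply: is_derive_within => x /=; rewrite in_itv/=; exact: hd.
- move=> + e; rewrite in_itv/= => /hp h.
  by rewrite -subr_gt0 e mulr_gt0// subr_gt0.
Qed.

Lemma pos_of_is_derive f (df : R -> R) :
  (forall x, is_derive x 1 f (df x)) -> f 0 = 0 ->
  (forall x, 0 < x -> 0 < df x) -> forall x, 0 < x -> 0 < f x.
Proof.
move=> hd f0 hp x x0; rewrite -f0; apply: (incr_of_is_derive x0 (fun y _ => hd y)) => y.
by case/andP => y0 _; exact: hp.
Qed.

End Derivatives.

(** * Functions with derivatives of all orders on an open set *)

Section Smooth.
Context {R : realType}.
Implicit Types (f g : R -> R) (x a b : R) (J I : set R).

(** Continuity of the last derivative is not part of level [n]. Required at every [n], as in
    [smooth], the condition is C^oo on [J]. *)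
Fixpoint Ck J (n : nat) f : Prop :=
  if n is n'.+1 then (forall x, J x -> derivable f x 1) /\ Ck J n' f^`()%classic
  else True.

Definition smooth J f := forall n, Ck J n f.

Lemma smooth_derive1 J f : smooth J f -> smooth J f^`()%classic.
Proof. by move=> h n; have [] := h n.+1. Qed.

Lemma smooth_is_derive J f x : smooth J f -> J x ->
  is_derive x 1 f (f^`()%classic x).
Proof. by move=> h Jx; apply: derivable_is_derive; have [+ _] := h 1%N; apply. Qed.

Lemma Ck_ext J n f g : open J -> (forall y, J y -> f y = g y) ->
  Ck J n f -> Ck J n g.
Proof.
move=> oJ; elim: n f g => //= n IH f g fg [df cf]; split.
  move=> x Jx; have := is_derive_open_ext oJ Jx fg (derivable_is_derive (df x Jx)).
  by case.
apply: IH cf => x Jx; apply/esym/is_derive_derive1.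
exact: is_derive_open_ext oJ Jx fg (derivable_is_derive (df x Jx)).
Qed.

(** The inductive step in usable form: a formula [df] valid only on [J] replaces the global
    derivative function, which is arbitrary outside [J]. *)
Lemma CkS J n f (df : R -> R) : open J ->
  (forall x, J x -> is_derive x 1 f (df x)) -> Ck J n df -> Ck J n.+1 f.
Proof.
move=> oJ hf cdf; split; first by move=> x /hf[].
by apply: Ck_ext cdf => // y Jy; apply/esym/is_derive_derive1/hf.
Qed.

Lemma CkW J n f : Ck J n.+1 f -> Ck J n f.
Proof. by elim: n f => //= n IH f [df /IH]. Qed.

Lemma Ck_is_derive J n f x : Ck J n.+1 f -> J x ->
  is_derive x 1 f (f^`()%classic x).
Proof. by move=> [h _] Jx; apply: derivable_is_derive; exact: h. Qed.

Lemma CkI J I n f : I `<=` J -> Ck J n f -> Ck I n f.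
Proof.
move=> IJ; elim: n f => //= n IH f [df /IH cf]; split => // x Ix.
exact/df/IJ.
Qed.

Lemma Ck_cst J n (k : R) : open J -> Ck J n (fun=> k).
Proof.
move=> oJ; elim: n k => // n IH k; exact: CkS (IH 0).
Qed.

Lemma Ck_id J n : open J -> Ck J n id.
Proof.
move=> oJ; case: n => // n; apply: (@CkS J n id (fun=> 1)) => //.
exact: Ck_cst.
Qed.

Lemma CkD J n f g : open J -> Ck J n f -> Ck J n g ->
  Ck J n (fun x => f x + g x).
Proof.
move=> oJ; elim: n f g => // n IH f g cf cg.
apply: (@CkS _ _ _ (fun x => f^`()%classic x + g^`()%classic x)) => //.
  by move=> x Jx; apply: is_derive_addf; apply: (@Ck_is_derive J n).
by apply: IH; [case: cf|case: cg].
Qed.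

Lemma CkM J n f g : open J -> Ck J n f -> Ck J n g ->
  Ck J n (fun x => f x * g x).
Proof.
move=> oJ; elim: n f g => // n IH f g cf cg.
apply: (@CkS _ _ _ (fun x => f^`()%classic x * g x + f x * g^`()%classic x)) => //.
  by move=> x Jx; apply: is_derive_mulf; apply: (@Ck_is_derive J n).
by apply: CkD => //; apply: IH; (try exact: CkW); [case: cf|case: cg].
Qed.

Lemma Ck_comp J I n f g : open J -> open I -> (forall x, J x -> I (g x)) ->
  Ck I n f -> Ck J n g -> Ck J n (fun x => f (g x)).
Proof.
move=> oJ oI JI; elim: n f g JI => // n IH f g JI cf cg.
apply: (@CkS _ _ _ (fun x => f^`()%classic (g x) * g^`()%classic x)) => //.
  move=> x Jx; apply: is_derive_compf; last exact: (@Ck_is_derive J n).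
  by apply: (@Ck_is_derive I n) => //; exact: JI.
apply: CkM => //; last by case: cg.
by apply: IH => //; [case: cf|exact: CkW].
Qed.

Lemma open_neq0 : open [set x : R | x != 0]. Proof. exact: open_neq. Qed.

Lemma Ck_inv n : Ck [set x : R | x != 0] n (fun x => x^-1).
Proof.
have oJ := open_neq0.
elim: n => // n IH.
apply: (@CkS _ _ _ (fun x => (-1) * (x^-1 * x^-1))) => //.
  move=> x /= x0; apply: is_derive_eq (is_derive_invf x0 (is_derive_id _ _)) _.
  by rewrite mulN1r div1r expr2 invfM.
by apply: CkM => //; [exact: Ck_cst|exact: CkM].
Qed.

Lemma Ck_expR J n : open J -> Ck J n expR.
Proof.
move=> oJ; elim: n => // n IH; exact: CkS IH.
Qed.

Lemma open_gt0 : open [set x : R | 0 < x]. Proof. exact: open_gt. Qed.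

Lemma Ck_ln n : Ck [set x : R | 0 < x] n (@ln R).
Proof.
case: n => // n; apply: (@CkS _ _ _ (fun x => x^-1)); first exact: open_gt0.
by apply: (@CkI [set x | x != 0]) (Ck_inv n) => x /=; exact: lt0r_neq0.
Qed.

(** The two are proved together because each derivative is, up to sign, the other function. *)
Lemma Ck_cossin J n : open J -> Ck J n (@cos R) /\ Ck J n (@sin R).
Proof.
move=> oJ; elim: n => // n [cc cs]; split.
  apply: (@CkS _ _ _ (fun x => (-1) * sin x)) => //.
    by move=> x _; apply: is_derive_eq (is_derive_cos x) _; rewrite mulN1r.
  by apply: CkM => //; exact: Ck_cst.
exact: CkS cc.
Qed.

Lemma smooth_cst J (k : R) : open J -> smooth J (fun=> k).
Proof. by move=> oJ n; exact: Ck_cst. Qed.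

Lemma smooth_id J : open J -> smooth J id.
Proof. by move=> oJ n; exact: Ck_id. Qed.

Lemma smoothD J f g : open J -> smooth J f -> smooth J g ->
  smooth J (fun x => f x + g x).
Proof. by move=> oJ sf sg n; exact: CkD. Qed.

Lemma smoothM J f g : open J -> smooth J f -> smooth J g ->
  smooth J (fun x => f x * g x).
Proof. by move=> oJ sf sg n; exact: CkM. Qed.

Lemma smoothN J f : open J -> smooth J f -> smooth J (fun x => - f x).
Proof.
move=> oJ sf; under eq_fun do rewrite -mulN1r.
by apply: smoothM => //; exact: smooth_cst.
Qed.

Lemma smoothV J f : open J -> (forall x, J x -> f x != 0) -> smooth J f ->
  smooth J (fun x => (f x)^-1).
Proof.
move=> oJ f0 sf n.
exact: (Ck_comp oJ open_neq0 f0 (Ck_inv n) (sf n)).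
Qed.

Lemma smooth_comp J I f g : open J -> open I -> (forall x, J x -> I (g x)) ->
  smooth I f -> smooth J g -> smooth J (fun x => f (g x)).
Proof. by move=> oJ oI JI sf sg n; apply: (@Ck_comp J I). Qed.

Lemma smooth_exp J f : open J -> smooth J f -> smooth J (fun x => expR (f x)).
Proof.
move=> oJ; apply: (@smooth_comp J setT) => //; first exact: openT.
by move=> n; apply: Ck_expR; exact: openT.
Qed.

Lemma smooth_cos J f : open J -> smooth J f -> smooth J (fun x => cos (f x)).
Proof.
move=> oJ; apply: (@smooth_comp J setT) => //; first exact: openT.
by move=> n; have [] := @Ck_cossin setT n openT.
Qed.

Lemma smooth_sin J f : open J -> smooth J f -> smooth J (fun x => sin (f x)).
Proof.
move=> oJ; apply: (@smooth_comp J setT) => //; first exact: openT.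
by move=> n; have [] := @Ck_cossin setT n openT.
Qed.

Lemma smooth_ln J f : open J -> (forall x, J x -> 0 < f x) -> smooth J f ->
  smooth J (fun x => ln (f x)).
Proof.
move=> oJ f0 sf n.
exact: (Ck_comp oJ open_gt0 f0 (Ck_ln n) (sf n)).
Qed.

Lemma smooth_powR J f (e : R) : open J -> (forall x, J x -> 0 < f x) ->
  smooth J f -> smooth J (fun x => f x `^ e).
Proof.
move=> oJ f0 sf n; apply: (@Ck_ext J n (fun x => expR (e * ln (f x)))) => //.
  by move=> x Jx; rewrite /powR gt_eqF// f0.
apply: smooth_exp => //; apply: smoothM; [by []|exact: smooth_cst|].
exact: smooth_ln.
Qed.

Lemma smooth_sqrt J f : open J -> (forall x, J x -> 0 < f x) ->
  smooth J f -> smooth J (fun x => Num.sqrt (f x)).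
Proof.
move=> oJ f0 sf n; apply: (@Ck_ext J n (fun x => f x `^ (2^-1))) => //.
  by move=> x Jx; rewrite powR12_sqrt// ltW// f0.
exact: smooth_powR.
Qed.

(** Bootstrapping: the derivative of [g] is the inverse of f' composed with [g], so [n] derivatives
    of [g] give one more. *)
Lemma smooth_inverse (J I : set R) f g : open J -> open I ->
  (forall y, J y -> I (g y) /\ f (g y) = y) ->
  (forall x, I x -> g (f x) = x) ->
  smooth I f -> (forall x, I x -> f^`()%classic x != 0) -> smooth J g.
Proof.
move=> oJ oI gJ gf sf f0; elim=> // n IH.
apply: (@CkS _ _ _ (fun y => (f^`()%classic (g y))^-1)) => //.
  move=> y Jy; have [Igy fgy] := gJ y Jy.
  have nI : \forall x \near g y, I x by exact: open_nbhs_nbhs.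
  rewrite -{1}fgy; apply: is_derive_inverse.
  - by near=> x; apply: gf; near: x.
  - near=> x; have Ix : I x by near: x.
    exact: is_derive_continuous (smooth_is_derive sf Ix).
  - exact: (smooth_is_derive sf).
  - exact: f0.
apply: (@Ck_comp J I n (fun x => (f^`()%classic x)^-1)) => //.
- by move=> y /gJ[].
- by apply: smoothV => //; exact: smooth_derive1.
Unshelve. all: by end_near. Qed.

End Smooth.

(** * The branch function *)

Section ExponentialInequalities.
Context {R : realType}.
Variable d : R.
Hypothesis d_gt0 : 0 < d.
Implicit Types (u v k : R).

Definition ex k v : R := expR (k * v).

Lemma ex_gt0 k v : 0 < ex k v. Proof. exact: expR_gt0. Qed.

Lemma ex0 k : ex k 0 = 1. Proof. by rewrite /ex mulr0 expR0. Qed.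

Lemma exD k l v : ex (k + l) v = ex k v * ex l v.
Proof. by rewrite /ex mulrDl expRD. Qed.

Lemma exN k v : ex k (- v) = ex (- k) v.
Proof. by rewrite /ex mulrN mulNr. Qed.

Lemma exV k v : ex (- k) v = (ex k v)^-1.
Proof. by rewrite /ex mulNr expRN. Qed.

Lemma ex_ltk k l v : 0 < v -> k < l -> ex k v < ex l v.
Proof. by move=> v0 kl; rewrite /ex ltr_expR ltr_pM2r. Qed.

Lemma is_derive_ex k v : is_derive v 1 (ex k) (k * ex k v).
Proof.
have h : is_derive v 1 (fun y : R => k * y) (0 * v + k * 1).
  exact: is_derive_mulf (is_derive_cstf k v) (is_derive_idf v).
by apply: is_derive_eq (is_derive_expf h) _; rewrite /ex; ring.
Qed.

(** Up to positive factors, [fA] and [fB] are for v > 0 the numerators of [kappa], the logarithmic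
    derivative of [sigma], and of [1 - kappa]. *)
Definition fA v : R := d - (d + 1) * ex (- 1) v + ex (- (d + 1)) v.
Definition fB v : R := 1 - (d + 1) * ex (- d) v + d * ex (- (d + 1)) v.

(** One differentiation formula for [fA], [fA'] and [fEn]; absent terms get the coefficient 0. *)
Lemma is_derive_ex3 a b k l j r s v :
  is_derive v 1 (fun v => a * ex k v + b * ex l v + r * ex j v + s)
    (a * (k * ex k v) + b * (l * ex l v) + r * (j * ex j v)).
Proof.
have h q i : is_derive v 1 (fun v => q * ex i v) (q * (i * ex i v)).
  apply: is_derive_eq (is_derive_mulf (is_derive_cstf q v) (is_derive_ex i v)) _.
  by ring.
have h1 := is_derive_addf (is_derive_addf (h a k) (h b l)) (h r j).
by apply: is_derive_eq (is_derive_addf h1 (is_derive_cstf s v)) _; ring.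
Qed.

Definition fA' v : R := (d + 1) * (ex (- 1) v - ex (- (d + 1)) v).

Lemma is_derive_fA v : is_derive v 1 fA (fA' v).
Proof.
apply: is_derive_congr (is_derive_ex3 (- (d + 1)) 1 (- 1) (- (d + 1)) 0 0 d v) _ _.
  by apply/funext => x; rewrite /fA; ring.
by rewrite /fA'; ring.
Qed.

Lemma fA_gt0 v : 0 < v -> 0 < fA v.
Proof.
apply: (pos_of_is_derive is_derive_fA) => [|x x0].
  by rewrite /fA !ex0; ring.
by rewrite /fA' mulr_gt0 ?subr_gt0 ?ex_ltk ?addr_gt0// ltrN2 ltrDr.
Qed.

Lemma is_derive_fA' v :
  is_derive v 1 fA' ((d + 1) * ((d + 1) * ex (- (d + 1)) v - ex (- 1) v)).
Proof.
apply: is_derive_congr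
  (is_derive_ex3 (d + 1) (- (d + 1)) (- 1) (- (d + 1)) 0 0 0 v) _ _.
  by apply/funext => x; rewrite /fA'; ring.
by ring.
Qed.

Lemma decr_1Dx_expN u v : 0 < u -> u < v -> (1 + v) * ex (- 1) v < (1 + u) * ex (- 1) u.
Proof.
move=> u0 uv; rewrite -ltrN2.
apply: (@incr_of_is_derive _ (fun u => - ((1 + u) * ex (- 1) u))
  (fun u => u * ex (- 1) u) _ _ uv) => x /andP[ux _].
  have h : is_derive x 1 (fun y : R => 1 + y) (0 + 1).
    exact: is_derive_addf (is_derive_cstf 1 x) (is_derive_idf x).
  apply: is_derive_eq (is_derive_oppf (is_derive_mulf h (is_derive_ex (- 1) x))) _.
  by ring.
by rewrite mulr_gt0 ?ex_gt0//; lra.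
Qed.

(** This says that fA / v^2 decreases. The difference of the two sides vanishes at 0, and its
    derivative [K'] compares (1 + x) e^(-x) at [v] and at (d + 1) v. *)
Lemma fA'_bound v : 0 < v -> v * fA' v < 2 * fA v.
Proof.
move=> v0; rewrite -subr_gt0.
pose K' v := (d + 1) * ((1 + v) * ex (- 1) v - (1 + (d + 1) * v) * ex (- (d + 1)) v).
apply: (@pos_of_is_derive _ (fun v => 2 * fA v - v * fA' v) K') v0 => [x||x x0].
- have h1 := is_derive_mulf (is_derive_cstf 2 x) (is_derive_fA x).
  have h2 := is_derive_mulf (is_derive_idf x) (is_derive_fA' x).
  apply: is_derive_eq (is_derive_subf h1 h2) _.
  by rewrite /K' /fA'; ring.
- by rewrite /fA' /fA !ex0; ring.
- rewrite /K'; apply: mulr_gt0; first by rewrite addr_gt0.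
  rewrite subr_gt0.
  have -> : ex (- (d + 1)) x = ex (- 1) ((d + 1) * x) by rewrite /ex; congr expR; ring.
  by apply: decr_1Dx_expN => //; rewrite mulrDl mul1r ltrDr mulr_gt0.
Qed.

(** This is [fB] multiplied by e^((d + 1/2) v), the normalization in which it enters the derivative
    of [bF]. *)
Definition fE v : R := ex (d + 2^-1) v - (d + 1) * ex (2^-1) v + d * ex (- 2^-1) v.

Let e1 := d + 2^-1.
(** The [i]-th derivative of [fE]. Since [fE] vanishes to second order at 0, signs are propagated
    downwards from the third derivative. *)
Definition fEn (i : nat) v : R :=
  e1 ^+ i * ex e1 v - (d + 1) * (2^-1) ^+ i * ex (2^-1) v
  + d * (- 2^-1) ^+ i * ex (- 2^-1) v.

Lemma is_derive_fEn i v : is_derive v 1 (fEn i) (fEn i.+1 v).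
Proof.
apply: is_derive_congr (is_derive_ex3 (e1 ^+ i) (- ((d + 1) * (2^-1) ^+ i))
  e1 (2^-1) (- 2^-1) (d * (- 2^-1) ^+ i) 0 v) _ _.
  by apply/funext => x; rewrite /fEn; ring.
by rewrite /fEn !exprS; ring.
Qed.

Lemma fEn3_gt0 v : 0 < v -> 0 < fEn 3 v.
Proof.
move=> v0.
have h1 : ex 2^-1 v < ex e1 v by apply: ex_ltk => //; rewrite /e1; have := d_gt0; lra.
have h2 : ex (- 2^-1) v < ex 2^-1 v by apply: ex_ltk => //; lra.
have h3 := ex_gt0 2^-1 v.
have e13 : 0 < e1 ^+ 3 by rewrite exprn_gt0// /e1; have := d_gt0; lra.
have q1 := ltr_pM2l e13 (ex 2^-1 v) (ex e1 v).
have q2 : d * ex (- 2^-1) v < d * ex 2^-1 v by rewrite ltr_pM2l.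
have q3 : 0 < (d * (d + 1) * (d + 2^-1)) * ex 2^-1 v.
  by rewrite mulr_gt0// !mulr_gt0 ?addr_gt0// invr_gt0.
(* The outer exponentials are compared with the middle one, e^(v/2); the remaining coefficient d (d
   + 1) (d + 1/2) is the sum of all three, the value at 0. *)
have -> : fEn 3 v = e1 ^+ 3 * (ex e1 v - ex 2^-1 v)
   + 8^-1 * (d * ex 2^-1 v - d * ex (- 2^-1) v)
   + (d * (d + 1) * (d + 2^-1)) * ex 2^-1 v.
  by rewrite /fEn /e1; field.
have : 0 < e1 ^+ 3 * (ex e1 v - ex 2^-1 v) by rewrite mulr_gt0// subr_gt0.
lra.
Qed.

Lemma fEn2_gt0 v : 0 < v -> 0 < fEn 2 v.
Proof.
move=> v0; have E20 : 0 < fEn 2 0.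
  have -> : fEn 2 0 = d * (d + 1) by rewrite /fEn !ex0 /e1; field.
  by rewrite mulr_gt0// addr_gt0.
apply: lt_trans E20 _; apply: (incr_of_is_derive v0 (fun x _ => is_derive_fEn 2 x)).
by move=> x /andP[/fEn3_gt0].
Qed.

Lemma fEn1_gt0 v : 0 < v -> 0 < fEn 1 v.
Proof.
apply: (pos_of_is_derive (is_derive_fEn 1)) => [|x]; last exact: fEn2_gt0.
by rewrite /fEn !ex0 /e1; field.
Qed.

Lemma fEE v : fE v = fEn 0 v.
Proof. by rewrite /fE /fEn !expr0 /e1; ring. Qed.

Lemma is_derive_fE v : is_derive v 1 fE (fEn 1 v).
Proof. by rewrite (_ : fE = fEn 0) ?(funext fEE)//; exact: is_derive_fEn. Qed.

Lemma fE_gt0 v : 0 < v -> 0 < fE v.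
Proof.
apply: (pos_of_is_derive is_derive_fE) => [|x]; last exact: fEn1_gt0.
by rewrite /fE !ex0; ring.
Qed.

(** This says that fE / v^2 increases. The difference [M] and its derivative [M'] vanish at 0, and
    the second derivative is v times the positive third derivative of [fE]. *)
Lemma fE'_bound v : 0 < v -> 2 * fE v < v * fEn 1 v.
Proof.
pose M v := v * fEn 1 v - 2 * fE v.
pose M' v := v * fEn 2 v - fEn 1 v.
have dM (x : R) : is_derive x 1 M (M' x).
  have h1 := is_derive_mulf (is_derive_cstf 2 x) (is_derive_fE x).
  have h2 := is_derive_mulf (is_derive_idf x) (is_derive_fEn 1 x).
  apply: is_derive_eq (is_derive_subf h2 h1) _.
  by rewrite /M'; ring.
have dM' (x : R) : is_derive x 1 M' (x * fEn 3 x).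
  have h2 := is_derive_mulf (is_derive_idf x) (is_derive_fEn 2 x).
  apply: is_derive_eq (is_derive_subf h2 (is_derive_fEn 1 x)) _.
  by ring.
move=> v0; rewrite -subr_gt0; apply: (pos_of_is_derive dM) v0 => [|y].
  by rewrite /M /fE /fEn !ex0 /e1; field.
apply: (pos_of_is_derive dM') => [|z z0].
  by rewrite /M' /fEn !ex0 /e1; field.
by rewrite mulr_gt0// fEn3_gt0.
Qed.

(* [fE / fA] is increasing because [fA] grows slower and [fE] faster than [v ^+ 2]. *)
Lemma fE_fA_incr u v : 0 < u -> u < v -> fE u * fA v < fE v * fA u.
Proof.
move=> u0 uv; have v0 := lt_trans u0 uv.
rewrite -ltr_pdivlMr ?fA_gt0// mulrAC -ltr_pdivrMr ?fA_gt0//.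
apply: (@incr_of_is_derive _ (fun x => fE x / fA x)
  (fun x => (fEn 1 x * fA x - fE x * fA' x) / fA x ^+ 2) _ _ uv) => x /andP[ux _].
- have x0 : 0 < x by exact: lt_le_trans ux.
  have A0 : fA x != 0 by rewrite gt_eqF// fA_gt0.
  apply: is_derive_eq (is_derive_mulf (is_derive_fE x)
    (is_derive_invf A0 (is_derive_fA x))) _.
  by field.
- have x0 : 0 < x by exact: lt_trans ux.
  rewrite divr_gt0 ?exprn_gt0 ?fA_gt0//.
  rewrite -(pmulr_rgt0 _ x0) mulrBr subr_gt0.
  apply: (@lt_trans _ _ (2 * fE x * fA x)).
    rewrite mulrCA [ltRHS](_ : _ = fE x * (2 * fA x)); last by ring.
    by rewrite ltr_pM2l ?fE_gt0// fA'_bound.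
  by rewrite mulrA ltr_pM2r ?fA_gt0// fE'_bound.
Qed.

Lemma fB_fE v : ex (2^-1) v * fB v = ex (- d) v * fE v.
Proof.
rewrite /fB /fE mulrDr mulrBr mulr1 [RHS]mulrDr mulrBr -!exD.
rewrite !(mulrCA (ex _ v)) -!exD.
by congr (ex _ v - _ * ex _ v + _ * ex _ v); field.
Qed.

Lemma fB_gt0 v : 0 < v -> 0 < fB v.
Proof.
move=> v0; rewrite -(pmulr_rgt0 _ (ex_gt0 2^-1 v)) fB_fE.
by rewrite mulr_gt0 ?ex_gt0 ?fE_gt0.
Qed.

End ExponentialInequalities.

(** * The function [sigma]: symmetry, monotonicity, continuity *)

Section Ratio.
Context {R : realType}.
Variable d : R.
Hypothesis d_gt0 : 0 < d.
Implicit Types (u v k : R).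

(** At 0 the quotient is 0/0 and the limit is prescribed; for d = (p - 1) / 2 it is the square of
    [tcrit p]. *)
Definition sigma v : R :=
  if v == 0 then d / (d + 1) else (1 - ex (- d) v) / (1 - ex (- (d + 1)) v).

Let c_gt0 : 0 < d + 1. Proof. by rewrite addr_gt0. Qed.

Lemma sub1_exN_gt0 k v : 0 < k -> 0 < v -> 0 < 1 - ex (- k) v.
Proof.
by move=> k0 v0; rewrite subr_gt0 /ex mulNr expR_lt1 oppr_lt0 mulr_gt0.
Qed.

Lemma sub1_exN_neq0 k v : 0 < k -> v != 0 -> 1 - ex (- k) v != 0.
Proof.
move=> k0 v0; rewrite subr_eq0 eq_sym /ex -expR0 (inj_eq (@expR_inj R)).
by rewrite mulNr oppr_eq0 mulf_neq0// gt_eqF.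
Qed.

Lemma sigma_neq0E v : v != 0 ->
  sigma v = (1 - ex (- d) v) / (1 - ex (- (d + 1)) v).
Proof. by move=> /negPf v0; rewrite /sigma v0. Qed.

Lemma sigma0 : sigma 0 = d / (d + 1). Proof. by rewrite /sigma eqxx. Qed.

(** Since 1 - e^(k v) = - e^(k v) (1 - e^(- k v)), a change of sign of [v] multiplies the quotient
    by e^(d v) / e^((d + 1) v). *)
Lemma sigmaN v : sigma (- v) = ex (- 1) v * sigma v.
Proof.
have [->|v0] := eqVneq v 0; first by rewrite oppr0 ex0 mul1r.
rewrite !sigma_neq0E ?oppr_eq0// !exN !opprK !exV.
have d1 := sub1_exN_neq0 d_gt0 v0; have c1 := sub1_exN_neq0 c_gt0 v0.
move: d1 c1; rewrite !exV exD => d1 c1.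
have := ex_gt0 d v; have := ex_gt0 1 v => /lt0r_neq0 + /lt0r_neq0.
move: d1 c1; move: (ex d v) (ex 1 v) => x y d1 c1 y0 x0.
have x1 : x * y - 1 != 0.
  by apply: contra_neq c1 => /eqP; rewrite subr_eq0 => /eqP ->; rewrite invr1 subrr.
by field; rewrite x0 y0 x1 -oppr_eq0 opprB x1.
Qed.

Lemma sigma_gt0 v : 0 < sigma v.
Proof.
suff h w : 0 < w -> 0 < sigma w.
  have [v0|v0|->] := ltgtP v 0; [|exact: h|by rewrite sigma0 divr_gt0].
  by rewrite -(opprK v) sigmaN mulr_gt0 ?ex_gt0// h// oppr_gt0.
by move=> w0; rewrite sigma_neq0E ?gt_eqF// divr_gt0// sub1_exN_gt0.
Qed.

Lemma sigma_gt v : 0 < v -> d / (d + 1) < sigma v.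
Proof.
move=> v0; rewrite sigma_neq0E ?gt_eqF//.
rewrite ltr_pdivrMr// mulrAC ltr_pdivlMr ?sub1_exN_gt0//.
by rewrite -subr_gt0; have := fB_gt0 d_gt0 v0; congr (_ < _); rewrite /fB; ring.
Qed.

Lemma sigma_lt v : v < 0 -> sigma v < d / (d + 1).
Proof.
rewrite -oppr_gt0 -{2}(opprK v) => v0; move: (- v) v0 => {}v v0.
rewrite sigmaN sigma_neq0E ?gt_eqF//.
rewrite mulrA ltr_pdivrMr ?sub1_exN_gt0// mulrAC ltr_pdivlMr//.
rewrite mulrBr mulr1 -exD -subr_gt0.
have := fA_gt0 d_gt0 v0; congr (_ < _).
by rewrite /fA (_ : -1 - d = - (d + 1)); ring.
Qed.

Lemma sigma_lt1 v : sigma v < 1.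
Proof.
have [v0|v0|->] := ltgtP v 0.
- by apply: lt_trans (sigma_lt v0) _; rewrite ltr_pdivrMr// mul1r ltrDl.
- rewrite sigma_neq0E ?gt_eqF// ltr_pdivrMr ?sub1_exN_gt0// mul1r.
  by rewrite ltrD2l ltrN2 ex_ltk// ltrN2 ltrDl.
- by rewrite sigma0 ltr_pdivrMr// mul1r ltrDl.
Qed.

Definition kappa v : R :=
  ex (- d) v * fA d v / ((1 - ex (- d) v) * (1 - ex (- (d + 1)) v)).

Lemma one_sub_kappa v : v != 0 ->
  1 - kappa v = fB d v / ((1 - ex (- d) v) * (1 - ex (- (d + 1)) v)).
Proof.
move=> v0; rewrite /kappa.
have d1 := sub1_exN_neq0 d_gt0 v0; have c1 := sub1_exN_neq0 c_gt0 v0.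
apply: (mulIf (mulf_neq0 d1 c1)); rewrite mulrBl !divfK ?mulf_neq0// /fA /fB.
have -> : ex (- (d + 1)) v = ex (- d) v * ex (- 1) v by rewrite -exD; congr (ex _ v); ring.
by ring.
Qed.

Lemma kappa_gt0 v : 0 < v -> 0 < kappa v.
Proof.
by move=> v0; rewrite /kappa divr_gt0 ?mulr_gt0 ?ex_gt0 ?fA_gt0 ?sub1_exN_gt0.
Qed.

Lemma kappa_lt1 v : 0 < v -> kappa v < 1.
Proof.
move=> v0; rewrite -subr_gt0 one_sub_kappa ?gt_eqF//.
by rewrite divr_gt0 ?mulr_gt0 ?fB_gt0 ?sub1_exN_gt0.
Qed.

Lemma is_derive_sigma v : v != 0 -> is_derive v 1 sigma (sigma v * kappa v).
Proof.
move=> v0.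
have d1 := sub1_exN_neq0 d_gt0 v0; have c1 := sub1_exN_neq0 c_gt0 v0.
apply: (is_derive_open_ext (f := fun x => (1 - ex (- d) x) / (1 - ex (- (d + 1)) x))
  open_neq0 v0) => [y y0|]; first by rewrite sigma_neq0E.
have h k := is_derive_subf (is_derive_cstf 1 v) (is_derive_ex k v).
apply: is_derive_eq (is_derive_mulf (h (- d)) 
  (@is_derive_invf _ (fun x => 1 - ex (- (d + 1)) x) _ _ c1 (h _))) _.
rewrite sigma_neq0E// /kappa /fA.
have e : ex (- (d + 1)) v = ex (- d) v * ex (- 1) v by rewrite -exD; congr (ex _ v); ring.
by rewrite e in c1 *; field; rewrite c1 d1.
Qed.

Lemma is_derive_sigmaN v : v != 0 ->
  is_derive v 1 (fun x => sigma (- x)) (sigma (- v) * (kappa v - 1)).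
Proof.
move=> v0.
have -> : (fun x => sigma (- x)) = (fun x => ex (- 1) x * sigma x).
  by apply/funext => x; rewrite sigmaN.
apply: is_derive_eq (is_derive_mulf (is_derive_ex (- 1) v) (is_derive_sigma v0)) _.
by rewrite sigmaN; ring.
Qed.

(** The logarithmic derivatives of [sigma v] and [sigma (- v)] are [kappa v] and [kappa v - 1], and
    [kappa] lies strictly between 0 and 1 on the positive half-line. *)
Lemma sigma_incr_pos u v : 0 < u -> u < v ->
  sigma u < sigma v /\ sigma (- v) < sigma (- u).
Proof.
move=> u0 uv; split; last rewrite -ltrN2.
- apply: (@incr_of_is_derive _ _ (fun x => sigma x * kappa x) _ _ uv) => x /andP[ux _].
    by apply: is_derive_sigma; rewrite gt_eqF// (lt_le_trans u0 ux).
  by rewrite mulr_gt0 ?sigma_gt0// kappa_gt0// (lt_trans u0 ux).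
- apply: (@incr_of_is_derive _ (fun x => - sigma (- x))
    (fun x => sigma (- x) * (1 - kappa x)) _ _ uv) => x /andP[ux _].
    have x0 : x != 0 by rewrite gt_eqF// (lt_le_trans u0 ux).
    by apply: is_derive_eq (is_derive_oppf (is_derive_sigmaN x0)) _; ring.
  by rewrite mulr_gt0 ?sigma_gt0// subr_gt0 kappa_lt1// (lt_trans u0 ux).
Qed.

Lemma sigma_incr u v : u < v -> sigma u < sigma v.
Proof.
move=> uv; have [u0|u0|u0] := ltgtP u 0; last 2 first.
- by have [] := sigma_incr_pos u0 uv.
- by move: uv; rewrite u0 => v0; rewrite sigma0 sigma_gt.
have [v0|v0|v0] := ltgtP v 0; last 2 first.
- exact: lt_trans (sigma_lt u0) (sigma_gt v0).
- by rewrite v0 sigma0 sigma_lt.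
have nv0 : 0 < - v by rewrite oppr_gt0.
have vu : - v < - u by rewrite ltrN2.
by have [_] := sigma_incr_pos nv0 vu; rewrite !opprK.
Qed.

(** As sigma v = e^v sigma (- v) and [sigma] crosses q = d / (d + 1) at 0, its value lies between q
    and e^v q. This yields continuity at 0 without expanding the quotient. *)
Lemma sigma_bound v : `|sigma v - d / (d + 1)| <= `|ex 1 v - 1| * (d / (d + 1)).
Proof.
have q0 : 0 < d / (d + 1) by rewrite divr_gt0.
have e : sigma v = ex 1 v * sigma (- v).
  by rewrite sigmaN mulrA -exD subrr /ex mul0r expR0 mul1r.
have [v0|v0|->] := ltgtP v 0; last by rewrite sigma0 subrr normr0 mulr_ge0// ltW.
- have h1 := sigma_lt v0.
  have h2 : ex 1 v * (d / (d + 1)) < sigma v.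
    by rewrite e ltr_pM2l ?ex_gt0// sigma_gt// oppr_gt0.
  have h3 : ex 1 v < 1 by rewrite /ex mul1r expR_lt1.
  rewrite ltr0_norm ?subr_lt0// ltr0_norm ?subr_lt0// opprB mulNr mulrBl mul1r.
  by rewrite opprB lerD2l lerN2 ltW.
- have h1 := sigma_gt v0.
  have h2 : sigma v < ex 1 v * (d / (d + 1)).
    by rewrite e ltr_pM2l ?ex_gt0// sigma_lt// oppr_lt0.
  have h3 : 1 < ex 1 v by rewrite /ex mul1r expR_gt1.
  rewrite gtr0_norm ?subr_gt0// gtr0_norm ?subr_gt0// mulrBl mul1r.
  by rewrite lerD2r ltW.
Qed.

Lemma continuous_sigma : continuous sigma.
Proof.
move=> v; have [->|v0] := eqVneq v 0; last exact: is_derive_continuous (is_derive_sigma v0).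
set q := d / (d + 1).
have ce : {for 0, continuous (fun x => `|ex 1 x - 1| * q)}.
  apply: cvgM; last exact: cvg_cst.
  apply: cvg_norm; apply: cvgB; last exact: cvg_cst.
  exact: is_derive_continuous (is_derive_ex 1 0).
have e0 : `|ex 1 0 - 1| * q = 0 by rewrite ex0 subrr normr0 mul0r.
rewrite /continuous_at sigma0 -/q.
have h : \forall x \near (0 : R),
    q - `|ex 1 x - 1| * q <= sigma x <= q + `|ex 1 x - 1| * q.
  by near=> x; rewrite -ler_distl; exact: sigma_bound.
have h1 := cvgB (@cvg_cst _ q _ (nbhs (0 : R)) _) ce.
have h2 := cvgD (@cvg_cst _ q _ (nbhs (0 : R)) _) ce.
by apply: (squeeze_cvgr h); [move: h1|move: h2]; rewrite e0 ?subr0 ?addr0; apply.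
Unshelve. all: by end_near. Qed.

End Ratio.

(** * The branch function [bF] and the sign of its derivative *)

Section BranchFunction.
Context {R : realType}.
Variable d : R.
Hypothesis d_gt0 : 0 < d.
Implicit Types (n m u v : R).

Definition bF n m v : R := n / Num.sqrt (sigma d (- v)) + m / Num.sqrt (sigma d v).

Lemma sqrt_sigma_gt0 v : 0 < Num.sqrt (sigma d v).
Proof. by rewrite sqrtr_gt0 sigma_gt0. Qed.

Lemma sqrt_ex k v : Num.sqrt (ex k v) = ex (k / 2) v.
Proof.
by rewrite -[RHS]ger0_norm ?ltW ?ex_gt0// -sqrtr_sqr expr2 -exD -splitr.
Qed.

Lemma sqrt_sigmaN v : Num.sqrt (sigma d (- v)) = ex (- 2^-1) v * Num.sqrt (sigma d v).
Proof.
by rewrite sigmaN// sqrtrM ?ltW ?ex_gt0// sqrt_ex mulN1r.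
Qed.

Lemma bFN n m v : bF n m (- v) = bF m n v.
Proof. by rewrite /bF opprK addrC. Qed.

Lemma bFE n m v : bF n m v = (n * ex 2^-1 v + m) / Num.sqrt (sigma d v).
Proof.
rewrite /bF sqrt_sigmaN exV invfM invrK.
have := sqrt_sigma_gt0 v; move/lt0r_neq0 => h.
by rewrite mulrA mulrDl.
Qed.

Lemma continuous_bF n m : continuous (bF n m).
Proof.
have h : continuous (fun v => Num.sqrt (sigma d v)).
  move=> v; apply: (@continuous_comp _ _ _ (sigma d) Num.sqrt).
    exact: continuous_sigma.
  exact: sqrt_continuous.
move=> v; rewrite /bF; apply: cvgD; apply: cvgM; try exact: cvg_cst.
  apply: cvgV; first by rewrite gt_eqF ?sqrt_sigma_gt0.
  apply: (@continuous_comp _ _ _ (fun x => - x) (fun v => Num.sqrt (sigma d v))).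
    exact: opp_continuous.
  exact: h.
by apply: cvgV; [rewrite gt_eqF ?sqrt_sigma_gt0|exact: h].
Qed.

Lemma bF_gt0 n m v : 0 < n -> 0 < m -> 0 < bF n m v.
Proof.
by move=> n0 m0; rewrite /bF addr_gt0// divr_gt0// sqrt_sigma_gt0.
Qed.

Lemma bF_lower n m v : 0 < n -> 0 < m -> n * ex 2^-1 v <= bF n m v.
Proof.
move=> n0 m0; rewrite bFE ler_pdivlMr ?sqrt_sigma_gt0//.
have p0 : 0 < n * ex 2^-1 v by rewrite mulr_gt0 ?ex_gt0.
have s1 : Num.sqrt (sigma d v) <= 1.
  by rewrite -sqrtr1 ler_wsqrtr// ltW// sigma_lt1.
apply: (@le_trans _ _ (n * ex 2^-1 v)); last by rewrite lerDl ltW.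
by rewrite ler_piMr// ltW.
Qed.

Lemma bF_unbounded n m y w : 0 < n -> 0 < m -> exists2 v, w < v & y < bF n m v.
Proof.
(* The second entry makes n (1 + v / 2), a lower bound of n e^(v/2), at least n + |y|. *)
move=> n0 m0; pose v := Num.max (w + 1) (2 * (`|y| / n)).
have hv1 : w + 1 <= v by rewrite /v le_max lexx.
have hv2 : 2 * (`|y| / n) <= v by rewrite /v le_max lexx orbT.
exists v; first by lra.
apply: lt_le_trans (bF_lower v n0 m0).
have h : 1 + 2^-1 * v <= ex 2^-1 v by rewrite /ex expR_ge1Dx.
have h2 : 1 + `|y| / n <= ex 2^-1 v by lra.
have : n * (1 + `|y| / n) <= n * ex 2^-1 v by rewrite ler_pM2l.
rewrite mulrDr mulr1 mulrCA divff ?gt_eqF// mulr1 => h3.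
have := ler_norm y; lra.
Qed.

(** Differentiating (n e^(v/2) + m) sigma^(-1/2) gives (n e^(v/2) (1 - kappa) - m kappa) / (2 sqrt
    sigma), and [fB_fE] exposes a common positive factor. Only the sign matters later, so the factor
    [k] stays existential. *)
Lemma is_derive_bF n m v : 0 < v -> exists2 k, 0 < k &
  is_derive v 1 (bF n m) (k * (n * fE d v - m * fA d v)).
Proof.
move=> v0; have vn0 : v != 0 by rewrite gt_eqF.
set s := Num.sqrt (sigma d v).
pose D := (1 - ex (- d) v) * (1 - ex (- (d + 1)) v).
have D0 : 0 < D by rewrite mulr_gt0// sub1_exN_gt0// addr_gt0.
exists (ex (- d) v / (2 * s * D)).
  by rewrite divr_gt0 ?ex_gt0// mulr_gt0// mulr_gt0// /s sqrt_sigma_gt0.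
have -> : bF n m = (fun v => (n * ex 2^-1 v + m) * (expR (- 2^-1 * ln (sigma d v)))).
  apply/funext => x; rewrite bFE; congr (_ * _).
  rewrite -powR12_sqrt ?ltW ?sigma_gt0// -powRN.
  by rewrite /powR gt_eqF// sigma_gt0.
have hs : expR (- 2^-1 * ln (sigma d v)) = s^-1.
  rewrite /s -powR12_sqrt ?ltW ?sigma_gt0// -powRN.
  by rewrite /powR gt_eqF// sigma_gt0.
have h1 := is_derive_addf (is_derive_mulf (is_derive_cstf n v)
  (is_derive_ex 2^-1 v)) (is_derive_cstf m v).
have hl := is_derive_compf (is_derive1_ln (sigma_gt0 d_gt0 v)) (is_derive_sigma d_gt0 vn0).
have h2 := is_derive_expf (is_derive_mulf (is_derive_cstf (- 2^-1) v) hl).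
apply: is_derive_eq (is_derive_mulf h1 h2) _; rewrite hs.
have s0 : s != 0 by rewrite gt_eqF// sqrt_sigma_gt0.
have sg0 : sigma d v != 0 by rewrite gt_eqF// sigma_gt0.
rewrite mul0r !add0r addr0 mulKf//.
have k1 : 1 - kappa d v = fB d v / D by rewrite one_sub_kappa.
have k2 : kappa d v = ex (- d) v * fA d v / D by [].
transitivity ((n * ex 2^-1 v * (1 - kappa d v) - m * kappa d v) / (2 * s)).
  by field.
rewrite k1 k2.
transitivity ((n * (ex 2^-1 v * fB d v) - m * (ex (- d) v * fA d v)) / D / (2 * s)).
  by field; rewrite s0 gt_eqF.
by rewrite fB_fE; field; rewrite s0 gt_eqF.
Qed.

Lemma is_derive_bFN n m v : v < 0 -> exists2 k, 0 < k &
  is_derive v 1 (bF n m) (- (k * (m * fE d (- v) - n * fA d (- v)))).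
Proof.
rewrite -oppr_gt0 => v0; have [k k0 hk] := is_derive_bF m n v0.
exists k => //.
have -> : bF n m = (fun x => bF m n (- x)) by apply/funext => x; rewrite bFN.
apply: is_derive_eq
  (is_derive_compf hk (is_derive_oppf (is_derive_idf v))) _.
by rewrite mulrN1.
Qed.

Lemma derivable_bF n m v : v != 0 -> derivable (bF n m) v 1.
Proof.
move=> v0; have [h|h|/eqP] := ltgtP v 0; last by rewrite (negPf v0).
- by have [k _ []] := is_derive_bFN n m h.
- by have [k _ []] := is_derive_bF n m h.
Qed.

(** The disjunction keeps 0 out of the open interval, because [derivable_bF] applies only away from
    0. *)
Lemma bF_incr_derive_ge0 n m a b u : a < u < b -> (0 <= a) || (b <= 0) ->
  (forall x y, a < x -> x < y -> y < b -> bF n m x < bF n m y) ->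
  0 <= (bF n m)^`()%classic u.
Proof.
move=> uab ab0 incr; apply: (@incr_derive1_ge0_itv _ _ false true a b).
- move=> x; rewrite inE/= in_itv/= => /andP[ax xb]; apply: derivable_bF.
  case/orP: ab0 => [a0|b0]; first by rewrite gt_eqF// (le_lt_trans a0).
  by rewrite lt_eqF// (lt_le_trans xb).
- move=> x y; rewrite !in_itv/= => /andP[ax _] /andP[_ yb] xy; exact: incr.
- by rewrite in_itv.
Qed.

(** Monotonicity gives only a nonnegative derivative, at the midpoint [u] of [a] and [v]. The strict
    growth of fE / fA between [u] and [v] (between - v and - u on the negative side) makes it
    strictly positive at [v]. *)
Lemma bF_derive_gt0 n m a v : 0 < n -> 0 < m -> a < v -> v != 0 ->
  (0 <= a) || (v <= 0) ->
  (forall x y, a < x -> x < y -> y < v -> bF n m x < bF n m y) ->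
  0 < (bF n m)^`()%classic v.
Proof.
move=> n0 m0 av v0 av0 incr; pose u := (a + v) / 2.
have au : a < u by rewrite /u; lra.
have uv : u < v by rewrite /u; lra.
have := @bF_incr_derive_ge0 n m a v u; rewrite au uv => /(_ isT av0 incr) hu.
case/orP: av0 => [a0|vle0].
- have up : 0 < u by exact: le_lt_trans au.
  have vp : 0 < v by exact: lt_trans uv.
  have [k k0 hk] := is_derive_bF n m up.
  have [l l0 hl] := is_derive_bF n m vp.
  rewrite (is_derive_derive1 hl) pmulr_rgt0// subr_gt0.
  move: hu; rewrite (is_derive_derive1 hk) pmulr_rge0// subr_ge0 => hu.
  have Au := fA_gt0 d_gt0 up; have Av := fA_gt0 d_gt0 vp.
  rewrite -(ltr_pM2r Au); apply: (@le_lt_trans _ _ (n * fE d u * fA d v)).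
    by rewrite mulrAC ler_pM2r.
  by rewrite -!mulrA ltr_pM2l// fE_fA_incr.
- have vn : v < 0 by rewrite lt_neqAle v0.
  have un : u < 0 by exact: lt_trans uv vn.
  have [k k0 hk] := is_derive_bFN n m un.
  have [l l0 hl] := is_derive_bFN n m vn.
  rewrite (is_derive_derive1 hl) -mulrN pmulr_rgt0// opprB subr_gt0.
  move: hu; rewrite (is_derive_derive1 hk) -mulrN pmulr_rge0// opprB subr_ge0 => hu.
  have nun : 0 < - u by rewrite oppr_gt0.
  have nvn : 0 < - v by rewrite oppr_gt0.
  have Au := fA_gt0 d_gt0 nun; have Av := fA_gt0 d_gt0 nvn.
  rewrite -(ltr_pM2r Au); apply: (@lt_le_trans _ _ (m * fE d (- u) * fA d (- v))).
    by rewrite -!mulrA ltr_pM2l// fE_fA_incr ?ltrN2.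
  by rewrite [leRHS]mulrAC ler_pM2r.
Qed.

(** At the critical point m fE (- b) = n fA (- b); since - v > - b, the growth of fE / fA makes m fE
    (- v) the larger term. This supplies the second monotone branch when the given one ends beyond
    [tcrit p]. *)
Lemma bF_derive_lt0 n m b v : 0 < n -> 0 < m -> v < b -> b < 0 ->
  (bF n m)^`()%classic b = 0 -> (bF n m)^`()%classic v < 0.
Proof.
move=> n0 m0 vb b0; have v0 := lt_trans vb b0.
have [k k0 hk] := is_derive_bFN n m b0.
have [l l0 hl] := is_derive_bFN n m v0.
rewrite (is_derive_derive1 hl) (is_derive_derive1 hk) oppr_lt0 pmulr_rgt0// subr_gt0.
move/eqP; rewrite oppr_eq0 mulf_eq0 gt_eqF//= subr_eq0 => /eqP e.
have nb : 0 < - b by rewrite oppr_gt0.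
have nv : 0 < - v by rewrite oppr_gt0.
have Ab := fA_gt0 d_gt0 nb; have Av := fA_gt0 d_gt0 nv.
rewrite -(ltr_pM2r Ab) [ltLHS]mulrAC -e -!mulrA ltr_pM2l//.
by rewrite fE_fA_incr ?ltrN2.
Qed.

Lemma smooth_sigma (J : set R) : open J -> (forall v, J v -> v != 0) ->
  smooth J (sigma d).
Proof.
move=> oJ J0 i; apply: (@Ck_ext _ J i
    (fun v => (1 - expR (- d * v)) * (1 - expR (- (d + 1) * v))^-1)) => //.
  by move=> v /J0 v0; rewrite sigma_neq0E.
have h k : smooth J (fun v => 1 - expR (k * v)).
  apply: smoothD => //; first exact: smooth_cst.
  apply: smoothN => //; apply: smooth_exp => //.
  by apply: smoothM => //; [exact: smooth_cst|exact: smooth_id].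
apply: smoothM => //; apply: smoothV => // v /J0 v0.
by apply: sub1_exN_neq0 => //; rewrite addr_gt0.
Qed.

Lemma smooth_sigmaN (J : set R) : open J -> (forall v, J v -> v != 0) ->
  smooth J (fun v => sigma d (- v)).
Proof.
move=> oJ J0; rewrite (_ : (fun _ => _) = fun v => ex (- 1) v * sigma d v).
  apply: smoothM => //; last exact: smooth_sigma.
  apply: smooth_exp => //.
  by apply: smoothM => //; [exact: smooth_cst|exact: smooth_id].
by apply/funext => v; rewrite sigmaN.
Qed.

Lemma smooth_bF n m (J : set R) : open J -> (forall v, J v -> v != 0) ->
  smooth J (bF n m).
Proof.
move=> oJ J0; rewrite /bF.
have h k f : smooth J f -> (forall v, J v -> 0 < f v) ->
    smooth J (fun v => k / Num.sqrt (f v)).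
  move=> sf f0; apply: smoothM => //; first exact: smooth_cst.
  apply: smoothV => //; last exact: smooth_sqrt.
  by move=> v Jv; rewrite gt_eqF// sqrtr_gt0 f0.
apply: smoothD => //.
- by apply: h => [|v _]; [exact: smooth_sigmaN|exact: sigma_gt0].
- by apply: h => [|v _]; [exact: smooth_sigma|exact: sigma_gt0].
Qed.

End BranchFunction.

(** * Parametrization of [xi] and [alpha] by [sigma] *)

Section Branch.
Context {R : realType}.
Variable p : R.
Hypothesis p_gt1 : 1 < p.
Implicit Types (n m u v s t : R).

Let d : R := (p - 1) / 2.
Let d_gt0 : 0 < d. Proof. by rewrite /d divr_gt0// subr_gt0. Qed.
Let c_gt0 : 0 < d + 1. Proof. by rewrite addr_gt0. Qed.

(* Pairs of distinct points with the same value of [hfun p] are exactly the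
   [(st (- v), st v)]: [v] parametrizes them by their ratio [ex (- 2^-1) v]. *)
Definition st v : R := Num.sqrt (sigma d v).

Lemma st_gt0 v : 0 < st v. Proof. exact: sqrt_sigma_gt0. Qed.

Lemma st_sqr v : st v ^+ 2 = sigma d v.
Proof. by rewrite sqr_sqrtr// ltW// sigma_gt0. Qed.

Lemma st_lt1 v : st v < 1.
Proof. by rewrite -sqrtr1 ltr_sqrt// sigma_lt1. Qed.

Lemma stN v : st (- v) = ex (- 2^-1) v * st v.
Proof. exact: sqrt_sigmaN. Qed.

Lemma st_mono : {mono st : u v / u < v}.
Proof.
apply: leW_mono; apply: le_mono => u v uv.
by rewrite ltr_sqrt ?sigma_gt0// sigma_incr.
Qed.

Lemma st_mono_le : {mono st : u v / u <= v}.
Proof.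
apply: le_mono => u v uv.
by rewrite ltr_sqrt ?sigma_gt0// sigma_incr.
Qed.

Lemma st_inj : injective st.
Proof. exact: inc_inj st_mono_le. Qed.

Lemma st0 : st 0 = tcrit p.
Proof.
rewrite /st /tcrit sigma0; congr Num.sqrt; rewrite /d.
by field; rewrite !gt_eqF//; have := p_gt1; lra.
Qed.

Lemma continuous_st : continuous st.
Proof.
move=> v; apply: (@continuous_comp _ _ _ (sigma d) Num.sqrt).
  exact: continuous_sigma.
exact: sqrt_continuous.
Qed.

Lemma st_surj t : 0 < t < 1 -> exists v, st v = t.
Proof.
move=> /andP[t0 t1].
(* For a = ln (t^2), [sigmaN] gives sigma a = t^2 sigma (- a), and [sigma] is below 1. *)
have [a a0 ha] : exists2 a, a <= 0 & sigma d a <= t ^+ 2.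
  exists (ln (t ^+ 2)); first by rewrite ln_le0// expr_le1// ltW.
  rewrite -[X in sigma d X]opprK sigmaN//.
  rewrite (_ : ex (-1) _ = t ^+ 2).
    by rewrite ler_piMr ?exprn_ge0 ?ltW// sigma_lt1.
  by rewrite /ex mulrN mulN1r opprK lnK// posrE exprn_gt0.
(* Here b solves e^(- d b) = 1 - t^2: the numerator of sigma b is t^2 and its denominator is below
   1. *)
have [b b0 hb] : exists2 b, 0 < b & t ^+ 2 <= sigma d b.
  have q0 : 0 < 1 - t ^+ 2 by rewrite subr_gt0 expr_lt1// ltW.
  have q1 : 1 - t ^+ 2 < 1 by rewrite ltrBlDr ltrDl exprn_gt0.
  have b0 : 0 < - ln (1 - t ^+ 2) / d by rewrite divr_gt0// oppr_gt0 ln_lt0// q0.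
  exists (- ln (1 - t ^+ 2) / d) => //.
  rewrite sigma_neq0E ?gt_eqF//.
  rewrite (_ : ex (- d) _ = 1 - t ^+ 2); last first.
    by rewrite /ex (_ : - d * _ = ln (1 - t ^+ 2)) ?lnK//; field; rewrite gt_eqF.
  rewrite opprB addrC subrK ler_pdivlMr ?sub1_exN_gt0//.
  by rewrite ler_piMr ?exprn_ge0 ?(ltW t0)// gerBl ltW// ex_gt0.
have ab : a <= b by exact: le_trans (ltW b0).
have [||v _ hv] := @IVT R (sigma d) a b (t ^+ 2) ab.
- by apply: continuous_subspaceT; exact: continuous_sigma.
- by rewrite ge_min ha le_max hb orbT.
by exists v; rewrite /st hv sqrtr_sqr ger0_norm// ltW.
Qed.

(** This is the equation that determines [sigma]: for s1 = e^(-v/2) s2, equality of [hfun p] at s1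
    and s2 reads 1 - s2^2 = e^(- d v) (1 - e^(- v) s2^2). *)
Lemma sub1_sigma v : 1 - sigma d v = ex (- d) v * (1 - sigma d (- v)).
Proof.
have [->|v0] := eqVneq v 0; first by rewrite oppr0 ex0 mul1r.
rewrite sigmaN// sigma_neq0E//.
have c1 := sub1_exN_neq0 c_gt0 v0.
have e : ex (- (d + 1)) v = ex (- d) v * ex (- 1) v by rewrite -exD; congr (ex _ v); ring.
by rewrite e in c1 *; field.
Qed.

Lemma powR_ex k v (e : R) : ex k v `^ e = ex (k * e) v.
Proof.
rewrite /powR gt_eqF ?ex_gt0// /ex expRK; congr expR; ring.
Qed.

Lemma hfun_st v : hfun p (st (- v)) = hfun p (st v).
Proof.
rewrite /hfun !st_sqr stN powRM ?ltW ?ex_gt0 ?st_gt0// powR_ex.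
rewrite (_ : - 2^-1 * (p - 1) = - d); last by rewrite /d; field.
by rewrite (sub1_sigma v) mulrCA mulrA.
Qed.

(** Once [v] is read off from the ratio s1 / s2, the hypothesis is a linear equation for s2^2 whose
    solution is sigma v. *)
Lemma hfun_eq s1 s2 : 0 < s1 -> s1 < s2 -> hfun p s1 = hfun p s2 ->
  exists2 v, 0 < v & s1 = st (- v) /\ s2 = st v.
Proof.
move=> s10 s12 hh; have s20 := lt_trans s10 s12.
pose v : R := - 2 * ln (s1 / s2).
have r0 : 0 < s1 / s2 by rewrite divr_gt0.
have r1 : s1 / s2 < 1 by rewrite ltr_pdivrMr// mul1r.
have v0 : 0 < v by rewrite /v mulNr -mulrN mulr_gt0// oppr_gt0 ln_lt0// r0.
have ev : ex (- 2^-1) v = s1 / s2.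
  by rewrite /ex /v mulrA mulrNN mulVf// mul1r lnK.
have s1E : s1 = ex (- 2^-1) v * s2 by rewrite ev divfK// gt_eqF.
suff s2E : s2 = st v by exists v => //; split => //; rewrite stN -s2E.
have ex2 : ex (- 2^-1) v ^+ 2 = ex (- 1) v.
  by rewrite expr2 -exD (_ : - 2^-1 - 2^-1 = - 1)//; field.
move: hh; rewrite /hfun {1 2}s1E powRM ?ltW ?ex_gt0// powR_ex exprMn ex2.
rewrite (_ : - 2^-1 * (p - 1) = - d); last by rewrite /d; field.
rewrite mulrAC mulrC => /mulfI; rewrite gt_eqF ?powR_gt0// => /(_ isT) h.
rewrite -[LHS]ger0_norm ?ltW// -sqrtr_sqr /st; congr Num.sqrt.
rewrite sigma_neq0E ?gt_eqF//.
have c1 := sub1_exN_gt0 c_gt0 v0.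
apply: (canRL (mulfK (lt0r_neq0 c1))).
have e : ex (- (d + 1)) v = ex (- d) v * ex (- 1) v by rewrite -exD; congr (ex _ v); ring.
rewrite e; move: h; set x := ex _ v; set y := ex _ v; move: (s2 ^+ 2) => z h.
have : z = 1 - x * (1 - y * z) by rewrite h; ring.
by move=> hz; rewrite mulrBr mulr1 {1}hz; ring.
Qed.

(** By [hfun_eq] the only competitor of [st v] is [st (- v)]; for v != 0 it lies on the wrong side
    of [tcrit p]. *)
Lemma xi_st v : xi p (st (- v)) = st v.
Proof.
apply: xget_unique.
  split.
  - by rewrite st_gt0 st_lt1.
  - by rewrite hfun_st.
  - by rewrite -st0 !st_mono_le oppr_le0.
  - by rewrite -st0 !st_mono_le oppr_ge0.
move=> s [/andP[s0 s1] hs lo hi].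
rewrite hfun_st in hs.
have [sv|sv|//] := ltgtP s (st v).
- have [w w0 [sw vw]] := hfun_eq s0 sv hs.
  move/st_inj: vw => vw; subst w.
  by move: lo; rewrite sw -st0 !st_mono_le oppr_le0 (ltW w0) oppr_ge0 leNgt w0 => /(_ isT).
- have [w w0 [vw sw]] := hfun_eq (st_gt0 v) sv (esym hs).
  move/st_inj: vw => vw; subst v.
  by move: hi; rewrite sw -st0 opprK !st_mono_le (ltW w0) leNgt w0 => /(_ isT).
Qed.

Lemma alpha_st (N n : nat) v : alpha N n p (st (- v)) = bF d n%:R (N - n)%:R v.
Proof. by rewrite /alpha xi_st. Qed.

End Branch.

(** * Smooth inverses of the branch function *)

Section BranchInverse.
Context {R : realType}.
Variables d n m vs : R.
Hypotheses (d_gt0 : 0 < d) (n_gt0 : 0 < n) (m_gt0 : 0 < m).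
Hypothesis incr : forall u v, vs < u -> u < v -> bF d n m u < bF d n m v.
Let F := bF d n m.

(** The inverse along the given branch: [bF] is injective there and unbounded. Smoothness is stated
    where [g] is nonzero, since the derivatives of [bF] are controlled away from 0. *)
Lemma bF_inverse_right : exists g : R -> R,
  [/\ forall y, F vs < y -> vs < g y /\ F (g y) = y,
      open [set y | F vs < y /\ g y <> 0] &
      smooth [set y | F vs < y /\ g y <> 0] g].
Proof.
have inj u v : vs < u -> vs < v -> F u = F v -> u = v.
  move=> hu hv e; have [uv|vu|//] := ltgtP u v.
  - by have := incr hu uv; rewrite -/F e ltxx.
  - by have := incr hv vu; rewrite -/F e ltxx.
pose g y := xget 0 [set v | vs < v /\ F v = y].
have gK v : vs < v -> g (F v) = v.
  move=> hv; apply: xget_unique => [//|u [hu e]]; exact: inj.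
have gP y : F vs < y -> vs < g y /\ F (g y) = y.
  move=> hy.
  have [w hw yw] := bF_unbounded d_gt0 y vs n_gt0 m_gt0.
  have [||v] := @IVT R F vs w y (ltW hw).
  - by apply: continuous_subspaceT; exact: continuous_bF.
  - by rewrite ge_min (ltW hy)/= le_max (ltW yw) orbT.
  rewrite in_itv/= => /andP[vsv _] hv.
  have vsv' : vs < v.
    by rewrite lt_neqAle vsv andbT; apply: contraTneq hy => ->; rewrite hv ltxx.
  by rewrite -hv gK.
(* At most the single value F 0 is excluded, which makes the domain open. *)
have g0 y : F vs < y -> (g y <> 0 <-> ~ (vs < 0 /\ y = F 0)).
  move=> hy; have [h1 h2] := gP y hy; split => [h [h3 h4]|h h3].
    by apply: h; rewrite h4 gK.
  by apply: h; rewrite -h3; split => //; rewrite h3 -h2 h3.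
exists g; have oJ : open [set y | F vs < y /\ g y <> 0].
  have [vs0|vs0] := ltP vs 0.
    rewrite (_ : [set _ | _] = [set y | F vs < y] `&` [set y | y != F 0]).
      by apply: openI; [exact: open_gt|exact: open_neq].
    apply/seteqP; split => y /= [hy]; rewrite g0// => h; split => //.
      by apply/eqP => e; apply: h.
    by case=> _ e; rewrite e eqxx in h.
  rewrite (_ : [set _ | _] = [set y | F vs < y]); first exact: open_gt.
  apply/seteqP; split => y /= => [[]//|hy]; split => //; rewrite g0//.
  by case => h; rewrite ltNge vs0 in h.
split => //.
pose I := [set v | vs < v] `&` [set v : R | v != 0].
have oI : open I by apply: openI; [exact: open_gt|exact: open_neq].
apply: (@smooth_inverse _ _ I F) => //.
- by move=> y [hy gy]; have [h1 h2] := gP y hy; do 2?split => //; apply/eqP.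
- by move=> v [hv _]; exact: gK.
- by apply: smooth_bF => // v [].
- move=> v [/= hv v0]; apply: lt0r_neq0.
  have [vle0|vgt0] := leP v 0.
    apply: (@bF_derive_gt0 _ _ d_gt0 n m vs) => //; first by rewrite vle0 orbT.
    by move=> x y h1 h2 _; exact: incr.
  (* For v > 0 monotonicity is used only on the part of the branch to the right of 0. *)
  apply: (@bF_derive_gt0 _ _ d_gt0 n m (Num.max vs 0)) => //.
  - by rewrite gt_max hv.
  - by rewrite le_max lexx orbT.
  - by move=> x y; rewrite gt_max => /andP[h1 _] h2 _; exact: incr.
Qed.

Hypothesis crit : vs < 0 -> F^`()%classic vs = 0.

(** If vs >= 0, the inverse along the given branch exceeds [vs] and never vanishes. Otherwise [vs]
    is a negative critical point, and the inverse is taken on the half-line below [vs], where [bF]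
    strictly decreases; [bFN] turns its growth at minus infinity into [bF_unbounded]. *)
Lemma bF_inverse_nonzero : exists g : R -> R,
  (forall y, F vs < y -> g y <> 0 /\ F (g y) = y) /\ smooth [set y | F vs < y] g.
Proof.
have [vs0|vs0] := ltP vs 0; last first.
  have [g [gP og sg]] := bF_inverse_right; exists g.
  have g0 y : F vs < y -> g y <> 0.
    by move=> hy e; have [+ _] := gP y hy; rewrite e ltNge vs0.
  split => [y hy|]; first by split; [exact: g0|exact: (gP y hy).2].
  suff <- : [set y | F vs < y /\ g y <> 0] = [set y | F vs < y] by [].
  by apply/seteqP; split => y /= => [[]//|hy]; split => //; exact: g0.
have dF v : v < vs -> F^`()%classic v < 0.
  by move=> hv; apply: (bF_derive_lt0 d_gt0 n_gt0 m_gt0 hv vs0); exact: crit.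
have decr u v : u < v -> v <= vs -> F v < F u.
  move=> uv hv; rewrite -ltrN2.
  apply: (@incr_of_is_derive _ (fun x => - F x) (fun x => - F^`()%classic x)) uv _ _.
    move=> x /andP[_ xv]; apply: is_derive_oppf; apply: derivable_is_derive.
    by apply: derivable_bF => //; rewrite lt_eqF// (le_lt_trans xv)// (le_lt_trans hv).
  by move=> x /andP[_ xv]; rewrite oppr_gt0 dF// (lt_le_trans xv).
pose g y := xget 0 [set v | v < vs /\ F v = y].
have gK v : v < vs -> g (F v) = v.
  move=> hv; apply: xget_unique => [//|u [hu e]].
  have [uv|vu|//] := ltgtP u v.
  - by have := decr u v uv (ltW hv); rewrite e ltxx.
  - by have := decr v u vu (ltW hu); rewrite e ltxx.
have gP y : F vs < y -> g y < vs /\ F (g y) = y.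
  move=> hy.
  have [w hw yw] := bF_unbounded d_gt0 y (- vs) m_gt0 n_gt0.
  have hw' : - w < vs by rewrite ltrNl.
  have [||v] := @IVT R F (- w) vs y (ltW hw').
  - by apply: continuous_subspaceT; exact: continuous_bF.
  - by rewrite ge_min (ltW hy) orbT le_max /F bFN (ltW yw).
  rewrite in_itv/= => /andP[_ vsv] hv.
  have vsv' : v < vs.
    by rewrite lt_neqAle vsv andbT; apply: contraTneq hy => <-; rewrite hv ltxx.
  by rewrite -hv gK.
exists g; split.
  move=> y hy; have [h1 h2] := gP y hy; split => // e.
  by move: h1; rewrite e ltNge ltW.
apply: (@smooth_inverse _ _ [set v | v < vs] F) => //.
- by apply: smooth_bF => //= v hv; rewrite lt_eqF// (lt_trans hv).
- by move=> v /dF /ltr0_neq0.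
Qed.

End BranchInverse.

(** * The end of the given branch in the new parameter *)

Section DecreasingBranchEnd.
Context {R : realType}.
Variables (N n : nat) (p tstar : R).
Hypotheses (p_gt1 : 1 < p) (ht : decreasing_branch_end N n p tstar).
Let d : R := (p - 1) / 2.
Let F := bF d n%:R (N - n)%:R.

(** As t = st (- v) decreases in v, the decreasing branch of [alpha] becomes an increasing one of
    [bF], to the right of [vs]. The local minimum gives a critical point; the case vs < 0 is the one
    with tstar > tcrit p. *)
Lemma branch_end_param : exists vs, [/\ st p (- vs) = tstar, alpha N n p tstar = F vs,
  forall u v, vs < u -> u < v -> F u < F v &
  vs < 0 -> F^`()%classic vs = 0].
Proof.
have d0 : 0 < d by rewrite /d divr_gt0// subr_gt0.
case: ht => t01 decr tmin.
have [w hw] := st_surj p_gt1 t01; exists (- w).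
rewrite opprK hw; split => //.
- by rewrite -hw -{1}(opprK w) alpha_st.
- move=> u v wu uv; have := decr (st p (- v)) (st p (- u)).
  rewrite !alpha_st//; apply; first exact: st_gt0.
    by rewrite st_mono// ltrN2.
  by rewrite -hw st_mono// ltrNl.
- move=> w0.
  have nF : \forall v \near (- w), F (- w) <= F v.
    have ct : (fun v => st p (- v)) @ (- w) --> st p w.
      rewrite -{2}(opprK w).
      apply: (@continuous_comp _ _ _ (fun v => - v) (st p)).
        exact: opp_continuous.
      exact: continuous_st.
    rewrite hw in ct.
    have h : \forall v \near (- w), alpha N n p tstar <= alpha N n p (st p (- v)).
      exact: ct tmin.
    apply: filterS h => v; rewrite -{1}hw -{1}(opprK w) !alpha_st//.
  have [e /= e0 he] := nF.
  (* The radius keeps the interval around - w both in the neighbourhood of minimality and to the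
     left of 0, where [bF] is derivable. *)
  pose r := Num.min e w.
  have r0 : 0 < r by rewrite lt_min e0 -oppr_lt0.
  have re : r <= e by rewrite ge_min lexx.
  have rw : r <= w by rewrite ge_min lexx orbT.
  have dv : derivable F (- w) 1 by apply: derivable_bF => //; rewrite lt_eqF.
  apply: is_derive_derive1.
  apply: (@derive1_at_min R F (- w - r) (- w + r)).
  - by rewrite lerD2l; lra.
  - move=> t; rewrite in_itv/= => /andP[_ h]; apply: derivable_bF => //.
    by rewrite lt_eqF//; apply: lt_le_trans h _; rewrite addrC subr_le0.
  - by rewrite in_itv/=; apply/andP; split; lra.
  - move=> t; rewrite in_itv/= => /andP[h1 h2]; apply: he => /=.
    by rewrite ltr_distlC; apply/andP; split; lra.
Qed.

End DecreasingBranchEnd.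

(** * Profiles and their derivatives *)

Section HyperbolicFunctions.
Context {R : realType}.
Implicit Types (x y : R).

Let csh_gt0 y : 0 < expR y + expR (- y). Proof. by rewrite addr_gt0 ?expR_gt0. Qed.

Lemma sech_gt0 y : 0 < sech y. Proof. by rewrite /sech divr_gt0. Qed.

Lemma sech_sqr y : sech y ^+ 2 = 1 - tanh y ^+ 2.
Proof.
rewrite /sech /tanh; have := csh_gt0 y; rewrite expRN.
have := expR_gt0 y => /lt0r_neq0; move: (expR y) => z z0 /lt0r_neq0 h.
have h2 : z * z + 1 != 0.
  apply: contra_neq h => h; apply: (mulfI z0).
  by rewrite mulrDr divff// h mulr0.
by field; rewrite h2 z0.
Qed.

Lemma tanh_norm y : `|tanh y| <= 1.
Proof.
rewrite /tanh normrM normfV (gtr0_norm (csh_gt0 y)) ler_pdivrMr// mul1r.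
by rewrite ler_norml; have := expR_gt0 y; have := expR_gt0 (- y); lra.
Qed.

Lemma sech_le y : sech y <= 2 * expR (- y).
Proof.
rewrite /sech ler_pM2l// [in leRHS]expRN lef_pV2 ?posrE ?expR_gt0//.
by rewrite lerDl expR_ge0.
Qed.

Let is_derive_expRN y : is_derive y 1 (fun x : R => expR (- x)) (- expR (- y)).
Proof.
apply: is_derive_eq (is_derive_expf (is_derive_oppf (is_derive_idf y))) _.
by rewrite mulrN1.
Qed.

Lemma is_derive_tanh y : is_derive y 1 (@tanh R) (1 - tanh y ^+ 2).
Proof.
have h1 := is_derive_subf (is_derive_expR y) (is_derive_expRN y).
have h2 := is_derive_addf (is_derive_expR y) (is_derive_expRN y).
have c0 := lt0r_neq0 (csh_gt0 y).
apply: is_derive_eq (is_derive_mulf h1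
  (@is_derive_invf _ (fun x => expR x + expR (- x)) _ _ c0 h2)) _.
by rewrite /tanh; field.
Qed.

Lemma is_derive_sech y : is_derive y 1 (@sech R) (- (sech y * tanh y)).
Proof.
have h2 := is_derive_addf (is_derive_expR y) (is_derive_expRN y).
have c0 := lt0r_neq0 (csh_gt0 y).
apply: is_derive_eq (is_derive_mulf (is_derive_cstf 2 y)
  (@is_derive_invf _ (fun x => expR x + expR (- x)) _ _ c0 h2)) _.
by rewrite /tanh /sech; field.
Qed.

Lemma is_derive_sech_powR (beta : R) y :
  is_derive y 1 (fun x => sech x `^ beta) (- beta * tanh y * sech y `^ beta).
Proof.
have e x : sech x `^ beta = expR (beta * ln (sech x)).
  by rewrite /powR gt_eqF// sech_gt0.
under eq_fun do rewrite e.
have h := is_derive_compf (is_derive1_ln (sech_gt0 y)) (is_derive_sech y).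
apply: is_derive_eq (is_derive_expf (is_derive_mulf (is_derive_cstf beta y) h)) _.
have s0 := lt0r_neq0 (sech_gt0 y).
by rewrite e; field.
Qed.

Lemma artanhK (t : R) : -1 < t < 1 -> tanh (artanh t) = t.
Proof.
move=> /andP[t1 t2].
have a0 : 0 < 1 + t by lra.
have b0 : 0 < 1 - t by lra.
have q0 : 0 < (1 + t) / (1 - t) by rewrite divr_gt0.
rewrite /tanh /artanh; set e := expR _.
have e0 : 0 < e by exact: expR_gt0.
have e2 : e * e = (1 + t) / (1 - t).
  by rewrite /e -expRD -splitr lnK.
rewrite expRN -/e.
have -> : (e - e^-1) / (e + e^-1) = (e * e - 1) / (e * e + 1).
  have h : e * e + 1 != 0 by rewrite gt_eqF// addr_gt0// mulr_gt0.
  by field; rewrite h gt_eqF.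
rewrite e2; field.
by rewrite gt_eqF//= gt_eqF//; lra.
Qed.

Lemma artanh_ltr (s t : R) : -1 < s -> s < t -> t < 1 -> artanh s < artanh t.
Proof.
move=> s1 st t1; rewrite /artanh ltr_pM2r//.
have hs : 0 < 1 - s by lra. have ht : 0 < 1 - t by lra.
rewrite ltr_ln ?posrE ?divr_gt0//; try lra.
rewrite ltr_pdivrMr// mulrAC ltr_pdivlMr//.
have : 0 < 2 * (t - s) by lra.
rewrite -subr_gt0 => h; rewrite -subr_gt0.
by move: h; congr (_ < _); ring.
Qed.

Lemma artanh0 : artanh 0 = 0 :> R.
Proof. by rewrite /artanh addr0 subr0 divr1 ln1 mul0r. Qed.

Lemma smooth_artanh (J : set R) (f : R -> R) : open J ->
  (forall x, J x -> -1 < f x < 1) -> smooth J f ->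
  smooth J (fun x => artanh (f x)).
Proof.
move=> oJ f1 sf; rewrite /artanh.
have sc k : smooth J (fun=> k) by exact: smooth_cst.
apply: smoothM => //; apply: smooth_ln => //.
  by move=> x /f1 /andP[h1 h2]; rewrite divr_gt0//; lra.
apply: smoothM => //; first exact: smoothD.
apply: smoothV => //.
  by move=> x /f1 /andP[h1 h2]; rewrite gt_eqF//; lra.
by apply: smoothD => //; exact: smoothN.
Qed.

End HyperbolicFunctions.

(** * A class of profiles closed under both derivatives *)

Section ProfileAlgebra.
Context {R : realType}.
Variables (L beta : R).

(* The x- and parameter-derivatives of [sech y `^ beta], where
   [y = b tau * (x - L) + a tau], are [sech y `^ beta] times polynomials in
   [x - L] ([PZ]) and [tanh y] ([PT]) with coefficients depending on [tau] ([PC]). *)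
Inductive pexp :=
  | PC of (R -> R) | PZ | PT | PAdd of pexp & pexp | PMul of pexp & pexp.

Section Fixed.
Variables (b a : R -> R).
Implicit Types (e f : pexp) (t x : R).

Definition arg t x : R := b t * (x - L) + a t.

Fixpoint peval e t x : R :=
  match e with
  | PC c => c t
  | PZ => x - L
  | PT => tanh (arg t x)
  | PAdd e f => peval e t x + peval f t x
  | PMul e f => peval e t x * peval f t x
  end.

Definition pfun e t x : R := sech (arg t x) `^ beta * peval e t x.

Fixpoint psmooth (J : set R) e : Prop :=
  match e with
  | PC c => smooth J c
  | PAdd e f | PMul e f => psmooth J e /\ psmooth J f
  | _ => True
  end.

Definition Pk (k : R) := PC (fun=> k).
Definition Psech2 := PAdd (Pk 1) (PMul (Pk (- 1)) (PMul PT PT)).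
Definition Pdarg := PAdd (PMul (PC b^`()%classic) PZ) (PC a^`()%classic).

Fixpoint dt e :=
  match e with
  | PC c => PC c^`()%classic
  | PZ => Pk 0
  | PT => PMul Pdarg Psech2
  | PAdd e f => PAdd (dt e) (dt f)
  | PMul e f => PAdd (PMul (dt e) f) (PMul e (dt f))
  end.

Fixpoint dx e :=
  match e with
  | PC c => Pk 0
  | PZ => Pk 1
  | PT => PMul (PC b) Psech2
  | PAdd e f => PAdd (dx e) (dx f)
  | PMul e f => PAdd (PMul (dx e) f) (PMul e (dx f))
  end.

(** [Dt] and [Dx] act on the polynomial factor alone; the added term is the logarithmic derivative
    of sech(y)^beta, namely - beta tanh y times the derivative of y. *)
Definition Dt e := PAdd (dt e) (PMul (PMul (Pk (- beta)) PT) (PMul Pdarg e)).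
Definition Dx e := PAdd (dx e) (PMul (PMul (Pk (- beta)) PT) (PMul (PC b) e)).

Let derive1_fun_cst (k t : R) : (fun=> k)^`()%classic t = 0.
Proof. exact: is_derive_derive1 (is_derive_cstf k t). Qed.

Lemma dt_dx e t x : peval (dt (dx e)) t x = peval (dx (dt e)) t x.
Proof.
elim: e => [c|||e IHe f IHf|e IHe f IHf] /=; rewrite ?derive1_fun_cst//.
- by ring.
- by rewrite IHe IHf.
- by rewrite IHe IHf; ring.
Qed.

(** The symmetry of mixed derivatives is a formal identity between evaluated expressions. *)
Lemma Dt_Dx e t x : peval (Dt (Dx e)) t x = peval (Dx (Dt e)) t x.
Proof. by rewrite /= !derive1_fun_cst dt_dx; ring. Qed.

Lemma is_derive_argx t x : is_derive x 1 (arg t) (b t).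
Proof.
rewrite /arg.
have h := is_derive_subf (is_derive_idf x) (is_derive_cstf L x).
apply: is_derive_eq (is_derive_addf (is_derive_mulf (is_derive_cstf (b t) x) h)
  (is_derive_cstf (a t) x)) _.
by ring.
Qed.

Lemma is_derive_pevalx e t x : is_derive x 1 (peval e t) (peval (dx e) t x).
Proof.
elim: e => [c|||e IHe f IHf|e IHe f IHf] /=.
- exact: is_derive_cstf.
- by apply: is_derive_eq (is_derive_subf (is_derive_idf x) (is_derive_cstf L x)) _; rewrite subr0.
- apply: is_derive_eq (is_derive_compf (is_derive_tanh _) (is_derive_argx t x)) _.
  by ring.
- exact: is_derive_addf.
- exact: is_derive_mulf.
Qed.

Lemma is_derive_pfunx e t x : is_derive x 1 (pfun e t) (pfun (Dx e) t x).
Proof.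
have h := is_derive_compf (is_derive_sech_powR beta _) (is_derive_argx t x).
apply: is_derive_eq (is_derive_mulf h (is_derive_pevalx e t x)) _.
by rewrite /pfun /=; ring.
Qed.

Variable J : set R.
Hypotheses (oJ : open J) (sb : smooth J b) (sa : smooth J a).

Lemma psmooth_dt e : psmooth J e -> psmooth J (dt e).
Proof.
have sc k : smooth J (fun=> k) by exact: smooth_cst.
have sb' := smooth_derive1 sb; have sa' := smooth_derive1 sa.
elim: e => [c|||e IHe f IHf|e IHe f IHf] //=.
- exact: smooth_derive1.
- by move=> [/IHe ? /IHf ?].
- by move=> [he hf]; have := IHe he; have := IHf hf.
Qed.

Lemma psmooth_dx e : psmooth J e -> psmooth J (dx e).
Proof.
have sc k : smooth J (fun=> k) by exact: smooth_cst.
elim: e => [c|||e IHe f IHf|e IHe f IHf] //=.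
- by move=> [/IHe ? /IHf ?].
- by move=> [he hf]; have := IHe he; have := IHf hf.
Qed.

Lemma psmooth_Dt e : psmooth J e -> psmooth J (Dt e).
Proof.
have sc : smooth J (fun=> - beta) by exact: smooth_cst.
have sb' := smooth_derive1 sb; have sa' := smooth_derive1 sa.
by move=> se; have := psmooth_dt se.
Qed.

Lemma psmooth_Dx e : psmooth J e -> psmooth J (Dx e).
Proof.
have sc : smooth J (fun=> - beta) by exact: smooth_cst.
by move=> se; have := psmooth_dx se.
Qed.

Lemma is_derive_argt t x : J t ->
  is_derive t 1 (fun t => arg t x) (peval Pdarg t x).
Proof.
move=> Jt; rewrite /arg /=; apply: is_derive_addf; last exact: smooth_is_derive sa Jt.
apply: is_derive_eq (is_derive_mulf (smooth_is_derive sb Jt) (is_derive_cstf (x - L) t)) _.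
by rewrite mulr0 addr0.
Qed.

Lemma is_derive_pevalt e t x : psmooth J e -> J t ->
  is_derive t 1 (fun t => peval e t x) (peval (dt e) t x).
Proof.
move=> + Jt; elim: e => [c|||e IHe f IHf|e IHe f IHf] //=.
- by move=> sc; exact: smooth_is_derive sc Jt.
- by move=> _; exact: is_derive_cstf.
- move=> _; apply: is_derive_eq (is_derive_compf (is_derive_tanh _) (is_derive_argt x Jt)) _.
  by rewrite /=; ring.
- by move=> [/IHe ? /IHf ?]; exact: is_derive_addf.
- by move=> [/IHe ? /IHf ?]; exact: is_derive_mulf.
Qed.

Lemma is_derive_pfunt e t x : psmooth J e -> J t ->
  is_derive t 1 (fun t => pfun e t x) (pfun (Dt e) t x).
Proof.
move=> se Jt.
have h := is_derive_compf (is_derive_sech_powR beta _) (is_derive_argt x Jt).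
apply: is_derive_eq (is_derive_mulf h (is_derive_pevalt x se Jt)) _.
by rewrite /pfun /=; ring.
Qed.

End Fixed.
End ProfileAlgebra.

(** * Exponential decay, locally uniform in the parameter *)

Section ProfileBounds.
Context {R : realType}.
Variables (L beta : R) (b a : R -> R) (J : set R).
Hypotheses (beta_gt0 : 0 < beta) (oJ : open J).
Hypotheses (sb : smooth J b) (sa : smooth J a) (b_gt0 : forall t, J t -> 0 < b t).
Implicit Types (e : @pexp R) (t x : R).
Local Notation peval := (peval L b a).
Local Notation pfun := (pfun L beta b a).
Local Notation Dt := (Dt beta b a).

Lemma near_dist_lt (c : R -> R) t0 (k : R) : {for t0, continuous c} -> 0 < k ->
  \forall t \near t0, `|c t0 - c t| < k.
Proof.
move=> ct k0; have ct' : c t @[t --> t0] --> c t0 by exact: ct.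
by move/cvgrPdist_lt: ct' => /(_ _ k0).
Qed.

Lemma near_le_of_continuous (c : R -> R) t0 : {for t0, continuous c} ->
  \forall t \near t0, `|c t| <= `|c t0| + 1.
Proof.
move=> ct; apply: filterS (near_dist_lt ct ltr01) => t ht.
have : `|c t| <= `|c t0| + `|c t - c t0|.
  by rewrite -{1}(subrK (c t0) (c t)) addrC; exact: ler_normD.
rewrite distrC in ht; lra.
Qed.

(** Polynomial growth is dominated by any exponential rate [k]; a product spends k / 2 on each
    factor. *)
Lemma peval_bound e t0 (k : R) : psmooth J e -> J t0 -> 0 < k -> exists2 M, 0 <= M &
  \forall t \near t0, forall x, L <= x -> `|peval e t x| <= M * expR (k * (x - L)).
Proof.
move=> + Jt0; elim: e k => [c|||e IHe f IHf|e IHe f IHf] k /= se k0.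
- exists (`|c t0| + 1); first by rewrite addr_ge0.
  have := near_le_of_continuous (is_derive_continuous (smooth_is_derive se Jt0)).
  apply: filterS => t ht x Lx; apply: (le_trans ht).
  by rewrite ler_peMr ?addr_ge0// -expR0 ler_expR mulr_ge0 ?(ltW k0)// subr_ge0.
- exists k^-1; first by rewrite invr_ge0 ltW.
  near=> t => x Lx; rewrite ger0_norm ?subr_ge0//.
  rewrite mulrC ler_pdivlMr// mulrC.
  have := expR_ge1Dx (k * (x - L)); lra.
- exists 1 => //; near=> t => x Lx; rewrite mul1r.
  apply: le_trans (tanh_norm _) _.
  by rewrite -expR0 ler_expR mulr_ge0 ?(ltW k0)// subr_ge0.
- have [M M0 hM] := IHe k se.1 k0; have [M' M'0 hM'] := IHf k se.2 k0.
  exists (M + M'); first by rewrite addr_ge0.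
  apply: filterS2 hM hM' => t h1 h2 x Lx.
  by apply: le_trans (ler_normD _ _) _; rewrite mulrDl lerD ?h1 ?h2.
- have k2 : 0 < k / 2 by rewrite divr_gt0.
  have [M M0 hM] := IHe _ se.1 k2; have [M' M'0 hM'] := IHf _ se.2 k2.
  exists (M * M'); first by rewrite mulr_ge0.
  apply: filterS2 hM hM' => t h1 h2 x Lx.
  have -> : k * (x - L) = k / 2 * (x - L) + k / 2 * (x - L) by field.
  by rewrite expRD mulrACA normrM ler_pM ?h1 ?h2.
Unshelve. all: by end_near. Qed.

(** The profile decays at rate beta b t. Half of beta b t0 is lost because b t is only bounded below
    by b t0 / 2 near t0, and half of the rest absorbs the polynomial factor. *)
Definition decay t0 : R := beta * b t0 / 4.

Lemma decay_gt0 t0 : J t0 -> 0 < decay t0.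
Proof. by move=> Jt0; rewrite /decay divr_gt0// mulr_gt0// b_gt0. Qed.

Lemma pfun_bound e t0 : psmooth J e -> J t0 -> exists2 M, 0 <= M &
  \forall t \near t0, forall x, L <= x ->
    `|pfun e t x| <= M * expR (- (decay t0 * (x - L))).
Proof.
move=> se Jt0; have d0 := decay_gt0 Jt0; have b0 := b_gt0 Jt0.
have [M M0 hM] := peval_bound se Jt0 d0.
(* The power of 2 comes from [sech_le], and a t0 - 1 is a lower bound for a t near t0. *)
pose M1 := 2 `^ beta * expR (- (beta * (a t0 - 1))).
have M10 : 0 <= M1 by rewrite mulr_ge0 ?powR_ge0 ?expR_ge0.
exists (M1 * M); first by rewrite mulr_ge0.
have ca := near_dist_lt (is_derive_continuous (smooth_is_derive sa Jt0)) ltr01.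
have b20 : 0 < b t0 / 2 by rewrite divr_gt0.
have cb := near_dist_lt (is_derive_continuous (smooth_is_derive sb Jt0)) b20.
have cab : \forall t \near t0, a t0 - 1 <= a t /\ b t0 / 2 <= b t.
  apply: filterS2 ca cb => t; rewrite !ltr_distlC => /andP[h1 h2] /andP[h3 h4].
  by split; lra.
apply: filterS2 hM cab => t h1 [h2 h3] x Lx.
have z0 : 0 <= x - L by rewrite subr_ge0.
have hy : b t0 / 2 * (x - L) + (a t0 - 1) <= arg L b a t x.
  by rewrite /arg lerD// ler_wpM2r.
have hs : sech (arg L b a t x) `^ beta
    <= M1 * expR (- (2 * decay t0 * (x - L))).
  apply: (@le_trans _ _ ((2 * expR (- (b t0 / 2 * (x - L) + (a t0 - 1)))) `^ beta)).
    apply: (ge0_ler_powR (ltW beta_gt0)).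
    - by rewrite nnegrE ltW// sech_gt0.
    - by rewrite nnegrE mulr_ge0// expR_ge0.
    by apply: le_trans (sech_le _) _; rewrite ler_pM2l// ler_expR lerN2.
  rewrite powRM ?expR_ge0// /M1 -[leRHS]mulrA ler_wpM2l ?powR_ge0//.
  rewrite -expRD /powR gt_eqF ?expR_gt0// expRK ler_expR /decay.
  by rewrite le_eqVlt; apply/orP; left; apply/eqP; field.
rewrite /pfun normrM (ger0_norm (powR_ge0 _ _)).
have -> : - (decay t0 * (x - L)) = - (2 * decay t0 * (x - L)) + decay t0 * (x - L).
  by ring.
by rewrite expRD mulrACA ler_pM ?powR_ge0// h1.
Qed.

Lemma mean_value_bound (f df : R -> R) t0 r K u w :
  (forall t, `|t - t0| <= r -> is_derive t 1 f (df t) /\ `|df t| <= K) ->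
  `|u - t0| <= r -> `|w - t0| <= r -> `|f u - f w| <= K * `|u - w|.
Proof.
move=> hf; wlog uw : u w / u <= w.
  move=> H hu hw; have [uw|/ltW wu] := leP u w; first exact: H.
  by rewrite distrC (distrC u); exact: H.
move=> hu hw.
have hb t : u <= t <= w -> `|t - t0| <= r.
  move=> /andP[ut tw]; move: hu hw; rewrite !ler_distl => /andP[h1 h2] /andP[h3 h4].
  by apply/andP; split; lra.
have [||c] := @MVT_segment R f df u w uw.
- by move=> t; rewrite in_itv/= => /andP[h1 h2]; apply: (hf _ _).1; apply: hb; rewrite !ltW.
- by apply: (@is_derive_within _ f df) => t /=; rewrite in_itv/= => /hb /hf[].
rewrite in_itv/= => /hb /hf[_ hc] e.
by rewrite distrC e normrM (distrC w) ler_wpM2r.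
Qed.

(** The mean value inequality needs the property on the whole segment between [t0] and [t]. *)
Lemma near_closed_ball (P : set R) t0 : (\forall t \near t0, P t) ->
  \forall t \near t0, forall s, `|s - t0| <= `|t - t0| -> P s.
Proof.
move=> [r /= r0 hr]; exists r => //= t /= tr s st; apply: hr => /=.
by rewrite distrC (le_lt_trans st)// distrC.
Qed.

Lemma pfun_lipschitz e t0 : psmooth J e -> J t0 -> exists2 M, 0 <= M &
  \forall t \near t0, forall x, L <= x ->
    `|pfun e t x - pfun e t0 x| <= M * `|t - t0| * expR (- (decay t0 * (x - L))).
Proof.
move=> se Jt0; have sde := psmooth_Dt beta oJ sb sa se.
have [M M0 hM] := pfun_bound sde Jt0; exists M => //.
have nJ : \forall t \near t0, J t by exact: open_nbhs_nbhs.
apply: filterS (near_closed_ball (filterI nJ hM)) => t ht x Lx.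
rewrite mulrAC; apply: (@mean_value_bound (fun t => pfun e t x)
  (fun t => pfun (Dt e) t x) t0 `|t - t0|) => //; last by rewrite subrr normr0.
move=> s /ht[Js hs].
by split; [exact: (is_derive_pfunt _ _ sb sa)|exact: hs].
Qed.

Lemma pfun_quotient e t0 : psmooth J e -> J t0 -> exists2 M, 0 <= M &
  \forall h \near (0 : R)^', forall x, L <= x ->
    `|h^-1 * (pfun e (t0 + h) x - pfun e t0 x) - pfun (Dt e) t0 x|
      <= M * `|h| * expR (- (decay t0 * (x - L))).
Proof.
move=> se Jt0; have sde := psmooth_Dt beta oJ sb sa se.
have [M M0 hM] := pfun_lipschitz sde Jt0; exists M => //.
have nJ : \forall t \near t0, J t by exact: open_nbhs_nbhs.
have := near_closed_ball (filterI nJ hM) => -[r /= r0 hr].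
near=> h => x Lx.
have h0 : h != 0 by near: h; exact: nbhs_dnbhs_neq.
have hltr : `|h| < r.
  near: h; apply: (@nbhs_dnbhs _ (0 : R)).
  by exists r => //= t /=; rewrite sub0r normrN.
have ah0 : 0 < `|h| by rewrite normr_gt0.
have hb s : `|s - t0| <= `|h| -> J s /\ forall x, L <= x ->
    `|pfun (Dt e) s x - pfun (Dt e) t0 x|
      <= M * `|s - t0| * expR (- (decay t0 * (x - L))).
  move=> sh; apply: (hr (t0 + h)) => /=.
    by rewrite opprD addNKr normrN.
  by rewrite addrAC subrr add0r.
rewrite -(ler_pM2l ah0) -normrM mulrBr mulVKf//.
set E := expR _.
(* The increment of g over [t0, t0 + h] is h times the quotient error, and its derivative is an
   increment of pfun (Dt e), of order |h| by [pfun_lipschitz]. *)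
pose g s := pfun e s x - pfun (Dt e) t0 x * s.
have hg s : `|s - t0| <= `|h| ->
    is_derive s 1 g (pfun (Dt e) s x - pfun (Dt e) t0 x) /\
    `|pfun (Dt e) s x - pfun (Dt e) t0 x| <= M * `|h| * E.
  move=> sh; have [Js hs] := hb s sh; split.
    apply: is_derive_eq (is_derive_subf (is_derive_pfunt L beta sb sa x se Js)
      (is_derive_mulf (is_derive_cstf (pfun (Dt e) t0 x) s) (is_derive_idf s))) _.
    by ring.
  apply: le_trans (hs x Lx) _.
  by rewrite ler_wpM2r ?expR_ge0// ler_wpM2l.
have := mean_value_bound hg (_ : `|(t0 + h) - t0| <= `|h|)
  (_ : `|t0 - t0| <= `|h|).
have -> : t0 + h - t0 = h by ring.
rewrite subrr normr0 lexx normr_ge0 => /(_ isT isT).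
rewrite mulrC; congr (`|_| <= _).
by rewrite /g; ring.
Unshelve. all: by end_near. Qed.

End ProfileBounds.

(** * Estimates in [L^2] and [H^2] *)

Section SquareIntegrals.
Context {R : realType}.
Variable L : R.
Local Notation mu := (@lebesgue_measure R).
Implicit Types (f : R -> R[i]).

Lemma integral_exp_decay (k : R) : 0 < k ->
  (\int[mu]_(x in `[L, +oo[) (expR (- (k * (x - L))))%:E = (k^-1)%:E)%E.
Proof.
move=> k0; pose F (x : R) := - (expR (- (k * (x - L))) / k).
have dF (x : R) : is_derive x 1 F (expR (- (k * (x - L)))).
  have h0 := is_derive_subf (is_derive_idf x) (is_derive_cstf L x).
  have h := is_derive_oppf (is_derive_mulf (is_derive_cstf k x) h0).
  have h2 := is_derive_mulf (is_derive_expf h) (is_derive_cstf k^-1 x).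
  apply: is_derive_eq (is_derive_oppf h2) _.
  by field; rewrite gt_eqF.
rewrite (@ge0_continuous_FTC2y R _ F L 0).
- by rewrite /F subrr mulr0 oppr0 expR0 div1r EFinN sub0e oppeK.
- by move=> x _; exact: expR_ge0.
- apply: continuous_subspaceT => x.
  have h0 := is_derive_subf (is_derive_idf x) (is_derive_cstf L x).
  have h := is_derive_oppf (is_derive_mulf (is_derive_cstf k x) h0).
  exact: is_derive_continuous (is_derive_expf h).
- rewrite -oppr0; apply: cvgN; rewrite -(mul0r k^-1); apply: cvgM; last exact: cvg_cst.
  have hk : (k * (x - L)) @[x --> +oo] --> +oo.
    apply/cvgryPge => A; near=> x.
    rewrite mulrC -ler_pdivrMr// lerBrDr.
    by near: x; apply: nbhs_pinfty_ge; rewrite num_real.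
  exact: (cvg_comp _ _ hk (@cvgr_expR R)).
- by move=> x _; case: (dF x).
- exact/cvg_at_right_filter/(is_derive_continuous (dF L)).
- by move=> x _; exact: is_derive_derive1 (dF x).
Unshelve. all: by end_near. Qed.

Lemma cmod_sqr (z : R[i]) : cmod z ^+ 2 = complex.Re z ^+ 2 + complex.Im z ^+ 2.
Proof. by case: z => u v /=; rewrite sqr_sqrtr// addr_ge0 ?sqr_ge0. Qed.

Lemma measurable_half_line (g : R -> R) : continuous g -> measurable_fun `[L, +oo[ g.
Proof. by move=> cg; apply: measurable_funTS; exact: continuous_measurable_fun. Qed.

Definition ReIm_continuous f :=
  continuous (fun x => complex.Re (f x)) /\ continuous (fun x => complex.Im (f x)).

Lemma sqint_ge0 f : (0 <= sqint L f)%E.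
Proof. by apply: integral_ge0 => x _; rewrite lee_fin sqr_ge0. Qed.

(** The squared modulus is at most 2 M^2 e^(- 2 k (x - L)), whose integral is M^2 / k. *)
Lemma sqint_le f (M k : R) : 0 < k -> 0 <= M -> ReIm_continuous f ->
  (forall x, L <= x -> `|complex.Re (f x)| <= M * expR (- (k * (x - L)))) ->
  (forall x, L <= x -> `|complex.Im (f x)| <= M * expR (- (k * (x - L)))) ->
  (sqint L f <= (M ^+ 2 / k)%:E)%E.
Proof.
move=> k0 M0 [cr ci] hr hi; rewrite /sqint.
have k20 : 0 < 2 * k by rewrite mulr_gt0.
have -> : (M ^+ 2 / k)%:E =
    (\int[mu]_(x in `[L, +oo[) ((2 * M ^+ 2)%:E * (expR (- (2 * k * (x - L))))%:E))%E.
  rewrite ge0_integralZl//.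
  - rewrite integral_exp_decay// -EFinM; congr EFin.
    by field; rewrite gt_eqF.
  - apply/measurable_EFinP; apply: measurable_half_line => x.
    have h0 := is_derive_subf (is_derive_idf x) (is_derive_cstf L x).
    have h := is_derive_oppf (is_derive_mulf (is_derive_cstf (2 * k) x) h0).
    exact: is_derive_continuous (is_derive_expf h).
  - by rewrite lee_fin mulr_ge0// sqr_ge0.
apply: ge0_le_integral => //.
- by move=> x _; rewrite lee_fin sqr_ge0.
- apply/measurable_EFinP; apply: (eq_measurable_fun
    (fun x : R => complex.Re (f x) ^+ 2 + complex.Im (f x) ^+ 2)) => [x _|].
    by rewrite cmod_sqr.
  by apply: measurable_funD; apply: measurable_funX; exact: measurable_half_line.
- apply/measurable_EFinP; apply: measurable_half_line => x.
  have h0 := is_derive_subf (is_derive_idf x) (is_derive_cstf L x).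
  have h := is_derive_oppf (is_derive_mulf (is_derive_cstf (2 * k) x) h0).
  have h2 := is_derive_mulf (is_derive_cstf (2 * M ^+ 2) x) (is_derive_expf h).
  exact: is_derive_continuous h2.
- move=> x; rewrite /= in_itv/= andbT => Lx.
  rewrite -EFinM lee_fin cmod_sqr.
  have sq (z : R) : `|z| <= M * expR (- (k * (x - L))) ->
      z ^+ 2 <= M ^+ 2 * expR (- (2 * k * (x - L))).
    move=> hz; have -> : - (2 * k * (x - L)) = - (k * (x - L)) + - (k * (x - L)) by ring.
    rewrite expRD -expr2 -exprMn -(real_normK (num_real z)).
    by rewrite lerXn2r// nnegrE mulr_ge0// expR_ge0.
  have := sq _ (hr x Lx); have := sq _ (hi x Lx); lra.
Qed.

Lemma L2_edge_decay f (M k : R) : 0 < k -> 0 <= M -> ReIm_continuous f ->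
  (forall x, L <= x -> `|complex.Re (f x)| <= M * expR (- (k * (x - L)))) ->
  (forall x, L <= x -> `|complex.Im (f x)| <= M * expR (- (k * (x - L)))) ->
  L2_edge L f.
Proof.
move=> k0 M0 cf hr hi; split.
- by apply: measurable_half_line; case: cf.
- by apply: measurable_half_line; case: cf.
- by apply: le_lt_trans (sqint_le k0 M0 cf hr hi) _; rewrite ltry.
Qed.

(** Stated for an arbitrary filter so that it serves both continuity, as s tends to t, and
    difference quotients, as h tends to 0 with h != 0. *)
Lemma sqint_cvg0 (T : Type) (F : set_system T) {FF : Filter F} (r : T -> R)
    (f : T -> R -> R[i]) (M k : R) : 0 < k -> 0 <= M ->
  (forall h, ReIm_continuous (f h)) -> r h @[h --> F] --> 0 ->
  (\forall h \near F, forall x, L <= x ->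
     `|complex.Re (f h x)| <= M * `|r h| * expR (- (k * (x - L)))) ->
  (\forall h \near F, forall x, L <= x ->
     `|complex.Im (f h x)| <= M * `|r h| * expR (- (k * (x - L)))) ->
  sqint L (f h) @[h --> F] --> 0%E.
Proof.
move=> k0 M0 cf r0 hr hi.
have hb : \forall h \near F,
    (0 <= sqint L (f h) <= ((M * `|r h|) ^+ 2 / k)%:E)%E.
  apply: filterS2 hr hi => h h1 h2; rewrite sqint_ge0/=.
  by apply: sqint_le => //; rewrite mulr_ge0.
apply: (squeeze_cvge hb); first exact: cvg_cst.
apply: cvg_EFin; first by near=> h.
have -> : (fine \o (fun h => ((M * `|r h|) ^+ 2 / k)%:E)) =
  (fun h => (M * `|r h|) * (M * `|r h|) / k) by apply/funext => h /=; rewrite expr2.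
have hz : (M * `|r h|) @[h --> F] --> 0.
  rewrite -(mulr0 M); apply: cvgM; first exact: cvg_cst.
  by rewrite -(@normr0 _ R); exact: cvg_norm.
rewrite -(mul0r k^-1) -[in X in _ --> X](mulr0 0).
by apply: cvgM; [exact: cvgM|exact: cvg_cst].
Unshelve. all: by end_near. Qed.

Lemma integral_derivative (f df : R -> R) x : L <= x ->
  (forall y : R, is_derive y 1 f (df y)) -> continuous df ->
  f x - f L = \int[mu]_(y in `[L, x]) df y.
Proof.
rewrite le_eqVlt => /predU1P[<-|Lx] hf cdf.
  by rewrite subrr set_itv1 /Rintegral integral_set1.
rewrite /Rintegral (@continuous_FTC2 _ _ f)//.
- exact: continuous_subspaceT.
- split.
  + by move=> y _; case: (hf y).
  + exact/cvg_at_right_filter/(is_derive_continuous (hf L)).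
  + exact/cvg_at_left_filter/(is_derive_continuous (hf x)).
- by move=> y _; exact: is_derive_derive1 (hf y).
Qed.

End SquareIntegrals.

(** * Smooth curves of graph functions in the operator domain *)

Section GraphCurve.
Context {R : realType} {N : nat}.
Variables (L beta Z : R) (b : R -> R) (a : 'I_N -> R -> R) (J : set R).
Hypotheses (beta_gt0 : 0 < beta) (oJ : open J) (sb : smooth J b).
Hypotheses (sa : forall j, smooth J (a j)) (b_gt0 : forall t, J t -> 0 < b t).
Implicit Types (e f : 'I_N -> @pexp R) (t x : R) (j k : 'I_N).

Local Notation pf j e := (pfun L beta b (a j) e).

Definition gfun e f t : graph_fun R N :=
  fun j x => (pf j (e j) t x +i* pf j (f j) t x)%C.

Definition gDt e j : pexp := Dt beta b (a j) (e j).
Definition gDx e j : pexp := Dx beta b (e j).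
Definition gsmooth e := forall j, psmooth J (e j).

Lemma gsmooth_Dt e : gsmooth e -> gsmooth (gDt e).
Proof. by move=> se j; apply: psmooth_Dt. Qed.

Lemma gsmooth_Dx e : gsmooth e -> gsmooth (gDx e).
Proof. by move=> se j; apply: psmooth_Dx. Qed.

Lemma pfun_Dt_Dx e j : pf j (gDt (gDx e) j) = pf j (gDx (gDt e) j).
Proof. by apply/funext => t; apply/funext => x; rewrite /pfun Dt_Dx. Qed.

(** Commutation is an equality of values, not of expressions, so it cannot be rewritten under an
    outer [gDx]. The first-order identity is differentiated in x instead. *)
Lemma pfun_Dt_Dx2 e j : pf j (gDt (gDx (gDx e)) j) = pf j (gDx (gDx (gDt e)) j).
Proof.
rewrite pfun_Dt_Dx; apply/funext => t; apply/funext => x.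
apply: (@is_derive_eqval _ (pf j (gDt (gDx e) j) t) x); first exact: is_derive_pfunx.
by rewrite pfun_Dt_Dx; exact: is_derive_pfunx.
Qed.

Lemma gfun_Dt_Dx e f t : gfun (gDt (gDx e)) (gDt (gDx f)) t =
  gfun (gDx (gDt e)) (gDx (gDt f)) t.
Proof.
by apply/funext => j; apply/funext => x; rewrite /gfun !pfun_Dt_Dx.
Qed.

Lemma gfun_Dt_Dx2 e f t : gfun (gDt (gDx (gDx e))) (gDt (gDx (gDx f))) t =
  gfun (gDx (gDx (gDt e))) (gDx (gDx (gDt f))) t.
Proof.
by apply/funext => j; apply/funext => x; rewrite /gfun !pfun_Dt_Dx2.
Qed.

Lemma continuous_pfun j (e : pexp) t : continuous (pf j e t).
Proof. by move=> x; exact: is_derive_continuous (is_derive_pfunx _ _ _ _ _ _ x). Qed.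

Lemma gfun_L2 e f t j : gsmooth e -> gsmooth f -> J t -> L2_edge L (gfun e f t j).
Proof.
move=> se sf Jt.
have [M M0 hM] := pfun_bound L beta_gt0 sb (sa j) b_gt0 (se j) Jt.
have [M' M'0 hM'] := pfun_bound L beta_gt0 sb (sa j) b_gt0 (sf j) Jt.
have MM : M <= Num.max M M' by rewrite le_max lexx.
have MM' : M' <= Num.max M M' by rewrite le_max lexx orbT.
apply: (@L2_edge_decay _ _ _ (Num.max M M') (decay beta b t)).
- exact: decay_gt0 Jt.
- exact: le_trans MM.
- by split; exact: continuous_pfun.
- move=> x Lx /=; apply: le_trans (nbhs_singleton hM x Lx) _.
  by rewrite ler_wpM2r ?expR_ge0.
- move=> x Lx /=; apply: le_trans (nbhs_singleton hM' x Lx) _.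
  by rewrite ler_wpM2r ?expR_ge0.
Qed.

Lemma L2_sqnorm_cvg0 (T : Type) (F : set_system T) {FF : Filter F}
    (U : T -> graph_fun R N) :
  (forall j, sqint L (U h j) @[h --> F] --> 0%E) ->
  L2_sqnorm L (U h) @[h --> F] --> 0%E.
Proof.
move=> hU; rewrite /L2_sqnorm.
elim: (index_enum _) => [|j r IH].
  by under eq_fun do rewrite big_nil; exact: cvg_cst.
under eq_fun do rewrite big_cons.
by have := cvgeD (isT : (0%E : \bar R) +? 0%E)%E (hU j) IH; rewrite adde0; exact.
Qed.

Lemma H2_sqnorm_cvg0 (T : Type) (F : set_system T) {FF : Filter F}
    (U U1 U2 : T -> graph_fun R N) :
  L2_sqnorm L (U h) @[h --> F] --> 0%E -> L2_sqnorm L (U1 h) @[h --> F] --> 0%E ->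
  L2_sqnorm L (U2 h) @[h --> F] --> 0%E ->
  H2_sqnorm L (U h) (U1 h) (U2 h) @[h --> F] --> 0%E.
Proof.
move=> h0 h1 h2; have zz : ((0%E : \bar R) +? 0%E)%E by [].
have := cvgeD zz h0 h1; rewrite adde0 => /(_ FF) h01.
by have := cvgeD zz h01 h2; rewrite adde0; exact.
Qed.

Lemma gfun_lipschitz e f t : gsmooth e -> gsmooth f -> J t ->
  L2_sqnorm L (fsub (gfun e f s) (gfun e f t)) @[s --> t] --> 0%E.
Proof.
move=> se sf Jt; apply: L2_sqnorm_cvg0 => j.
have [M M0 hM] := pfun_lipschitz L beta_gt0 oJ sb (sa j) b_gt0 (se j) Jt.
have [M' M'0 hM'] := pfun_lipschitz L beta_gt0 oJ sb (sa j) b_gt0 (sf j) Jt.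
have MM : M <= Num.max M M' by rewrite le_max lexx.
have MM' : M' <= Num.max M M' by rewrite le_max lexx orbT.
apply: (@sqint_cvg0 _ _ _ _ _ (fun s => s - t) _ (Num.max M M') (decay beta b t)).
- exact: decay_gt0 Jt.
- exact: le_trans MM.
- move=> h; split => x /=.
    by apply: cvgB; exact: continuous_pfun.
  by apply: cvgB; exact: continuous_pfun.
- have ht : {for t, continuous (fun s : R => s - t)}.
    exact: is_derive_continuous (is_derive_subf (is_derive_idf t) (is_derive_cstf t t)).
  have ht' : (s - t) @[s --> t] --> t - t by exact: ht.
  by rewrite subrr in ht'.
- apply: filterS hM => s hs x Lx /=; apply: le_trans (hs x Lx) _.
  by rewrite !ler_wpM2r ?expR_ge0.
- apply: filterS hM' => s hs x Lx /=; apply: le_trans (hs x Lx) _.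
  by rewrite !ler_wpM2r ?expR_ge0.
Qed.

Lemma quot_err_gfun e f e' f' t h j x :
  quot_err (gfun e f) (gfun e' f' t) t h j x =
  ((h^-1 * (pf j (e j) (t + h) x - pf j (e j) t x) - pf j (e' j) t x) +i*
   (h^-1 * (pf j (f j) (t + h) x - pf j (f j) t x) - pf j (f' j) t x))%C.
Proof.
rewrite /quot_err /gfun; apply/eqP; rewrite eq_complex /=.
by apply/andP; split; apply/eqP; ring.
Qed.

Lemma gfun_quotient e f t : gsmooth e -> gsmooth f -> J t ->
  L2_sqnorm L (quot_err (gfun e f) (gfun (gDt e) (gDt f) t) t h)
    @[h --> (0 : R)^'] --> 0%E.
Proof.
move=> se sf Jt; apply: L2_sqnorm_cvg0 => j.
have [M M0 hM] := pfun_quotient L beta_gt0 oJ sb (sa j) b_gt0 (se j) Jt.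
have [M' M'0 hM'] := pfun_quotient L beta_gt0 oJ sb (sa j) b_gt0 (sf j) Jt.
have MM : M <= Num.max M M' by rewrite le_max lexx.
have MM' : M' <= Num.max M M' by rewrite le_max lexx orbT.
apply: (@sqint_cvg0 _ _ _ _ _ id _ (Num.max M M') (decay beta b t)).
- exact: decay_gt0 Jt.
- exact: le_trans MM.
- move=> h; split; under eq_fun do rewrite quot_err_gfun /=.
    move=> x; apply: cvgB; last exact: continuous_pfun.
    by apply: cvgM; [exact: cvg_cst|apply: cvgB; exact: continuous_pfun].
  move=> x; apply: cvgB; last exact: continuous_pfun.
  by apply: cvgM; [exact: cvg_cst|apply: cvgB; exact: continuous_pfun].
- by apply: cvg_within_filter; exact: cvg_id.
- apply: filterS hM => h hh x Lx; rewrite quot_err_gfun; apply: le_trans (hh x Lx) _.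
  by rewrite !ler_wpM2r ?expR_ge0.
- apply: filterS hM' => h hh x Lx; rewrite quot_err_gfun; apply: le_trans (hh x Lx) _.
  by rewrite !ler_wpM2r ?expR_ge0.
Qed.

Lemma gfun_AC e f t j :
  AC_deriv L (gfun e f t j) (gfun (gDx e) (gDx f) t j).
Proof.
move=> x Lx /=; split; apply: integral_derivative => //.
- by move=> y; exact: is_derive_pfunx.
- exact: continuous_pfun.
- by move=> y; exact: is_derive_pfunx.
- exact: continuous_pfun.
Qed.

Definition vertex_cond e := forall t, J t -> forall j,
  (forall k, pf j (gDx e j) t L = pf k (gDx e k) t L) /\
  \sum_k pf k (e k) t L = Z * pf j (gDx e j) t L.

(** The vertex conditions are linear and hold throughout the open set [J], so they can be
    differentiated in the parameter. *)
Lemma vertex_cond_Dt e : gsmooth e -> vertex_cond e -> vertex_cond (gDt e).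
Proof.
move=> se ve t Jt j; have sx := gsmooth_Dx se.
have dpf k g : gsmooth g -> is_derive t 1 (fun t => pf k (g k) t L) (pf k (gDt g k) t L).
  by move=> sg; exact: (is_derive_pfunt _ _ sb (sa k) _ (sg k) Jt).
split=> [k|]; rewrite -!pfun_Dt_Dx.
  apply: is_derive_eqval (dpf j _ sx) _.
  apply: is_derive_open_ext oJ Jt _ (dpf k _ sx) => s Js.
  by have [] := ve s Js k.
have ds := @is_derive_sum _ _ _ _ (fun k t => pf k (e k) t L) t 1 _ (fun k => dpf k _ se).
apply: is_derive_eqval ds _.
have h := is_derive_mulf (is_derive_cstf Z t) (dpf j _ sx).
apply: is_derive_open_ext oJ Jt _ (is_derive_eq h _) => [s Js|]; last by ring.
by rewrite fct_sumE; have [_ ->] := ve s Js j.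
Qed.

Lemma gfun_dom e f t : gsmooth e -> gsmooth f -> vertex_cond e -> vertex_cond f ->
  J t -> delta'_dom_with Z L (gfun e f t) (gfun (gDx e) (gDx f) t)
    (gfun (gDx (gDx e)) (gDx (gDx f)) t).
Proof.
move=> se sf ve vf Jt; split.
- move=> j; split.
  + exact: gfun_L2.
  + by apply: gfun_L2 => //; exact: gsmooth_Dx.
  + by apply: gfun_L2 => //; do 2?exact: gsmooth_Dx; apply: gsmooth_Dx; exact: gsmooth_Dx.
  + exact: gfun_AC.
  + exact: gfun_AC.
- move=> j k; have [h1 _] := ve t Jt j; have [h2 _] := vf t Jt j.
  by rewrite /gfun (h1 k) (h2 k).
- move=> j; apply/eqP; rewrite eq_complex !raddf_sum /=.
  have [_ ->] := ve t Jt j; have [_ ->] := vf t Jt j.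
  by apply/andP; split; apply/eqP; ring.
Qed.

Variables e f : 'I_N -> @pexp R.
Hypotheses (se : gsmooth e) (sf : gsmooth f) (ve : vertex_cond e) (vf : vertex_cond f).

(** The index [i] counts parameter derivatives; the suffixes 1 and 2 of the next two definitions
    count x-derivatives. *)
Definition gder (i : nat) t := gfun (iter i gDt e) (iter i gDt f) t.
Definition gder1 (i : nat) t := gfun (gDx (iter i gDt e)) (gDx (iter i gDt f)) t.
Definition gder2 (i : nat) t :=
  gfun (gDx (gDx (iter i gDt e))) (gDx (gDx (iter i gDt f))) t.

Lemma gsmooth_iter g i : gsmooth g -> gsmooth (iter i gDt g).
Proof. by move=> sg; elim: i => //= i IH; exact: gsmooth_Dt. Qed.

Lemma vertex_cond_iter g i : gsmooth g -> vertex_cond g -> vertex_cond (iter i gDt g).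
Proof.
by move=> sg vg; elim: i => //= i IH; apply: vertex_cond_Dt => //; exact: gsmooth_iter.
Qed.

Lemma gder_dom i t : J t -> delta'_dom_with Z L (gder i t) (gder1 i t) (gder2 i t).
Proof.
by move=> Jt; apply: gfun_dom => //; [exact: gsmooth_iter|exact: gsmooth_iter|
  exact: vertex_cond_iter|exact: vertex_cond_iter].
Qed.

Lemma gder_continuous i t : J t ->
  H2_sqnorm L (fsub (gder i s) (gder i t)) (fsub (gder1 i s) (gder1 i t))
    (fsub (gder2 i s) (gder2 i t)) @[s --> t] --> 0%E.
Proof.
move=> Jt; have si := gsmooth_iter i se; have ti := gsmooth_iter i sf.
by apply: H2_sqnorm_cvg0; apply: gfun_lipschitz => //; do ?apply: gsmooth_Dx.
Qed.

Lemma gder_quotient i t : J t ->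
  H2_sqnorm L (quot_err (gder i) (gder i.+1 t) t h)
    (quot_err (gder1 i) (gder1 i.+1 t) t h)
    (quot_err (gder2 i) (gder2 i.+1 t) t h) @[h --> (0 : R)^'] --> 0%E.
Proof.
move=> Jt; have si := gsmooth_iter i se; have ti := gsmooth_iter i sf.
(* The parameter derivative is moved outermost, the form that [gfun_quotient] expects. *)
rewrite /gder1 /gder2 /= -!gfun_Dt_Dx -!gfun_Dt_Dx2.
by apply: H2_sqnorm_cvg0; apply: gfun_quotient => //; do ?apply: gsmooth_Dx.
Qed.

End GraphCurve.

(** * Standing waves *)

Section StandingWaves.
Context {R : realType}.
Variables (N n : nat) (L Z p : R).
Hypotheses (p_gt1 : 1 < p) (hn : (1 <= n <= N - 1)%N).
Implicit Types (om v t x : R).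

Let d : R := (p - 1) / 2.
Let d_gt0 : 0 < d. Proof. by rewrite /d divr_gt0// subr_gt0. Qed.
Let beta : R := 2 / (p - 1).
Let beta_gt0 : 0 < beta. Proof. by rewrite /beta divr_gt0// subr_gt0. Qed.
Let p1_gt0 : 0 < p - 1. Proof. by rewrite subr_gt0. Qed.

Local Notation st := (st p).
Local Notation F := (bF d n%:R (N - n)%:R).

Definition shiftL v : R := artanh (st (- v)).
Definition shiftR v : R := artanh (st v).

Lemma tanh_artanh_st v : tanh (artanh (st v)) = st v.
Proof. by rewrite artanhK// st_lt1// andbT (lt_trans _ (st_gt0 p_gt1 v))// ltrN10. Qed.

Lemma artanh_st_lt u v : u < v -> artanh (st u) < artanh (st v).
Proof.
move=> uv; rewrite artanh_ltr//; last exact: st_lt1.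
  by rewrite (lt_trans _ (st_gt0 p_gt1 u))// ltrN10.
by rewrite st_mono.
Qed.

Lemma shift_pair_st v : v != 0 ->
  exists aA aB, shift_pair p (shiftL v) (shiftR v) aA aB.
Proof.
have pos u : 0 < artanh (st u).
  by rewrite -artanh0 artanh_ltr ?st_gt0 ?st_lt1// ltrN10.
have ac : acrit p = artanh (st 0) by rewrite /acrit st0.
move=> v0; have [vn|vp|/eqP] := ltgtP v 0; last by rewrite (negPf v0).
- exists (shiftR v), (shiftL v); split; rewrite ?ac.
  + exact: pos.
  + exact: artanh_st_lt.
  + by apply: artanh_st_lt; rewrite oppr_gt0.
  + by right.
- exists (shiftL v), (shiftR v); split; rewrite ?ac.
  + exact: pos.
  + by apply: artanh_st_lt; rewrite oppr_lt0.
  + exact: artanh_st_lt.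
  + by left.
Qed.

Lemma branch_eq_st v om : F v = - Z * Num.sqrt om ->
  branch_eq N n p Z om (shiftL v) (shiftR v).
Proof.
move=> Fv; split; rewrite !tanh_artanh_st; last by rewrite xi_st.
by rewrite alpha_st.
Qed.

(** As sech^2 = 1 - tanh^2, the left side is the (p - 1)-th root of tanh^(p-1) sech^2. Hence equal
    vertex derivatives amount to equal values of [hfun p]. *)
Lemma sech_powR_tanh y : 0 < tanh y ->
  sech y `^ beta * tanh y = hfun p (tanh y) `^ (p - 1)^-1.
Proof.
move=> t0; have s0 := sech_gt0 y.
rewrite /hfun -sech_sqr powRM ?powR_ge0 ?sqr_ge0// -powRrM mulfV ?gt_eqF//.
rewrite powRr1 ?ltW// mulrC; congr (_ * _).
by rewrite -powR_mulrn ?ltW// -powRrM.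
Qed.

(** The two vertex conditions for [Theta] after division by the common amplitude: the derivative at
    the vertex is - sqrt om times amplitude times sech^beta tanh. *)
Definition balanced om (aL aR : R) : Prop :=
  sech aL `^ beta * tanh aL = sech aR `^ beta * tanh aR /\
  n%:R * sech aL `^ beta + (N - n)%:R * sech aR `^ beta =
    - Z * Num.sqrt om * (sech aL `^ beta * tanh aL).

(* With [T := hfun p t `^ (p - 1)^-1], the common value of [sech a `^ beta * tanh a],
   the vertex conditions become [T = T] and [T * F v = - Z * Num.sqrt om * T]. *)
Lemma balanced_st v om : F v = - Z * Num.sqrt om -> balanced om (shiftL v) (shiftR v).
Proof.
move=> Fv; have tL : tanh (shiftL v) = st (- v) := tanh_artanh_st _.
have tR : tanh (shiftR v) = st v := tanh_artanh_st _.
have sL := st_gt0 p_gt1 (- v); have sR := st_gt0 p_gt1 v.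
have hL := @sech_powR_tanh (shiftL v); rewrite tL in hL.
have hR := @sech_powR_tanh (shiftR v); rewrite tR in hR.
have hLR := etrans (hL sL) (etrans (congr1 (fun z => z `^ _) (hfun_st p_gt1 v)) (esym (hR sR))).
rewrite /balanced tL tR; split; first exact: hLR.
have alg (x y tx ty k l : R) : 0 < tx -> 0 < ty -> x * tx = y * ty ->
    k * x + l * y = (k / tx + l / ty) * (x * tx).
  move=> tx0 ty0 e; rewrite [RHS]mulrDl {2}e.
  by congr (_ + _); field; rewrite gt_eqF.
rewrite -Fv; exact: alg sL sR hLR.
Qed.

Let n_le : (n <= N)%N.
Proof. by case/andP: hn => _ h; apply: leq_trans h _; exact: leq_subr. Qed.

Lemma sum_split_edges (x y : R) :
  \sum_(k < N) (if (k < n)%N then x else y) = n%:R * x + (N - n)%:R * y.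
Proof.
rewrite -(big_mkord xpredT (fun k => if (k < n)%N then x else y)).
rewrite (big_cat_nat (leq0n n) n_le) /=; congr (_ + _).
  rewrite (eq_big_nat _ _ (F2 := fun=> x)) => [|i /andP[_ ->]//].
  by rewrite sumr_const_nat subn0 mulr_natl.
rewrite (eq_big_nat _ _ (F2 := fun=> y)) => [|i /andP[ni _]].
  by rewrite sumr_const_nat mulr_natl.
by rewrite ltnNge ni.
Qed.

Lemma vertex_discontinuous_balanced om (aL aR : R) : 0 < om -> balanced om aL aR ->
  tanh aL <> tanh aR -> vertex_discontinuous L (Theta N n p L om aL aR).
Proof.
move=> om0 [b1 _] tLR h; have /andP[n1 nN] := hn.
(* The edges 0 and N - 1 carry different shifts since 1 <= n <= N - 1. Equal vertex values force
   equal sech^beta, and the first balance equation then equal tanh. *)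
have N0 : (0 < N)%N by lia.
have N1 : (N - 1 < N)%N by lia.
have := h (Ordinal N0) (Ordinal N1); rewrite /Theta /= n1 ltnNge nN /=.
rewrite /Psi => -[]; rewrite subrr mulr0 !add0r.
have A0 : ((p + 1) * om / 2) `^ (p - 1)^-1 != 0.
  by rewrite gt_eqF// powR_gt0// divr_gt0// mulr_gt0// addr_gt0// (lt_trans _ p_gt1).
move=> /(mulfI A0) e; apply: tLR; rewrite -/beta in e.
by move: b1; rewrite e; apply: mulfI; rewrite gt_eqF// powR_gt0// sech_gt0.
Qed.

Lemma tanh_shift_neq v : v != 0 -> tanh (shiftL v) <> tanh (shiftR v).
Proof.
have tL : tanh (shiftL v) = st (- v) := tanh_artanh_st _.
have tR : tanh (shiftR v) = st v := tanh_artanh_st _.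
rewrite tL tR => v0 /(st_inj p_gt1) /eqP.
by rewrite -subr_eq0 -opprD oppr_eq0 -mulr2n mulrn_eq0/= (negPf v0).
Qed.

Definition amp om : R := ((p + 1) * om / 2) `^ (p - 1)^-1.
Definition wid om : R := (p - 1) / 2 * Num.sqrt om.
Definition edge_shift (a1 aN : R -> R) (j : 'I_N) : R -> R :=
  if (j < n)%N then a1 else aN.

(** The coefficient [c], amplitude times cosine or sine of the phase, is common to all edges and
    factors out of both linear conditions. *)
Lemma vertex_cond_balanced (J : set R) (b aL aR c om : R -> R) :
  (forall s, J s -> balanced (om s) (aL s) (aR s) /\ b s = wid (om s)) ->
  vertex_cond L beta Z b (edge_shift aL aR) J (fun=> PC c).
Proof.
move=> h s Js j; have [[b1 b2] bs] := h s Js.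
have bb : beta * b s = Num.sqrt (om s).
  by rewrite bs /wid /beta; field; rewrite gt_eqF.
have key k : pfun L beta b (edge_shift aL aR k) (gDx beta b (fun=> PC c) k) s L =
    - Num.sqrt (om s) * c s * (sech (aL s) `^ beta * tanh (aL s)).
  rewrite /pfun /= /arg subrr mulr0 add0r -bb /edge_shift.
  case: ifP => _; last rewrite b1; ring.
split=> [k|]; first by rewrite !key.
rewrite key.
transitivity (\sum_(k < N) (if (k < n)%N then sech (aL s) `^ beta * c s
    else sech (aR s) `^ beta * c s)).
  apply: eq_bigr => k _; rewrite /pfun /= /arg subrr mulr0 add0r /edge_shift.
  by case: ifP.
rewrite sum_split_edges.
transitivity ((n%:R * sech (aL s) `^ beta + (N - n)%:R * sech (aR s) `^ beta) * c s).
  by rewrite mulrDl !mulrA.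
by rewrite b2; ring.
Qed.

(** The parameter [s] is the frequency in [smooth_curve_st] and the time, with constant [om], in
    [standing_wave_st]. *)
Lemma phase_Theta (theta : R -> R) (b a1 aN om : R -> R) s :
  b s = wid (om s) ->
  gfun L beta b (edge_shift a1 aN) (fun=> PC (fun s => cos (theta s) * amp (om s)))
    (fun=> PC (fun s => sin (theta s) * amp (om s))) s =
  phase (theta s) (Theta N n p L (om s) (a1 s) (aN s)).
Proof.
move=> bs; apply/funext => j; apply/funext => x.
rewrite /phase /Theta /gfun /expi /Psi /pfun /= /arg bs /edge_shift.
have -> : (if (j < n)%N then a1 else aN) s = (if (j < n)%N then a1 s else aN s).
  by case: ifP.
rewrite -/(amp (om s)) -/beta -/(wid (om s)).
by apply/eqP; rewrite eq_complex /=; apply/andP; split; apply/eqP; ring.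
Qed.

Lemma pfun_Dx2_PC (b a c : R -> R) t x :
  pfun L beta b a (Dx beta b (Dx beta b (PC c))) t x =
  sech (arg L b a t x) `^ beta * (b t ^+ 2 *
    (beta ^+ 2 * tanh (arg L b a t x) ^+ 2 - beta * (1 - tanh (arg L b a t x) ^+ 2))
    * c t).
Proof. by rewrite /pfun /=; ring. Qed.

Lemma pfun_Dt_PC (b a c : R -> R) (c' : R) t x :
  is_derive t 1 b 0 -> is_derive t 1 a 0 -> is_derive t 1 c c' ->
  pfun L beta b a (Dt beta b a (PC c)) t x = sech (arg L b a t x) `^ beta * c'.
Proof.
move=> db da dc; rewrite /pfun /= (is_derive_derive1 db) (is_derive_derive1 da).
by rewrite (is_derive_derive1 dc); ring.
Qed.

(** The profile equation divided by the amplitude: the nonlinear factor is (p + 1) om / 2 times 1 -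
    tanh^2, which leaves a polynomial identity in tanh^2. *)
Lemma stationary_equation y om : 0 < om ->
  - om * sech y `^ beta + sech y `^ beta * (wid om ^+ 2 *
    (beta ^+ 2 * tanh y ^+ 2 - beta * (1 - tanh y ^+ 2)))
  + (amp om * sech y `^ beta) `^ (p - 1) * sech y `^ beta = 0.
Proof.
move=> om0; have s0 := sech_gt0 y.
have -> : (amp om * sech y `^ beta) `^ (p - 1) = (p + 1) * om / 2 * (1 - tanh y ^+ 2).
  have q0 : 0 <= (p + 1) * om / 2.
    by rewrite divr_ge0// mulr_ge0 ?(ltW om0)// addr_ge0// ltW// (lt_trans _ p_gt1).
  rewrite powRM ?powR_ge0// /amp -!powRrM mulVf ?gt_eqF// powRr1//.
  by rewrite /beta divfK ?gt_eqF// powR_mulrn ?ltW// sech_sqr.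
have -> : wid om ^+ 2 = (p - 1) ^+ 2 / 4 * om.
  by rewrite /wid exprMn sqr_sqrtr ?ltW//; field.
by rewrite /beta; field; rewrite gt_eqF.
Qed.

Lemma smooth_curve_st (J : set R) (v : R -> R) t : open J ->
  (forall om, J om -> 0 < om) -> (forall om, J om -> v om <> 0) -> smooth J v ->
  (forall om, J om -> F (v om) = - Z * Num.sqrt om) ->
  smooth_curve Z L J (fun om =>
    phase (t * om) (Theta N n p L om (shiftL (v om)) (shiftR (v om)))).
Proof.
move=> oJ J0 v0 sv Fv.
have sc k : smooth J (fun=> k) by exact: smooth_cst.
have sid : smooth J (fun om => om) by exact: smooth_id.
have ssqrt : smooth J (fun om => Num.sqrt om) by exact: smooth_sqrt.
have swid : smooth J wid by apply: smoothM.
have wid0 om : J om -> 0 < wid om.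
  by move=> /J0 om0; rewrite /wid mulr_gt0// sqrtr_gt0.
have samp : smooth J amp.
  apply: smooth_powR => //.
    by move=> om /J0 om0; rewrite divr_gt0// mulr_gt0// addr_gt0// (lt_trans _ p_gt1).
  by apply: smoothM => //; apply: smoothM.
have o0 := @open_neq0 R.
(* [smooth_sigma] and [smooth_sigmaN] apply away from 0, where [v] takes its values. *)
have v0' om : J om -> [set x | x != 0] (v om) by move=> /v0 /eqP.
have sL : smooth J (fun om => shiftL (v om)).
  apply: smooth_artanh => //.
    by move=> om _; rewrite st_lt1// andbT (lt_trans _ (st_gt0 p_gt1 _))// ltrN10.
  apply: smooth_sqrt => // [om _|]; first exact: sigma_gt0.
  exact: (smooth_comp oJ o0 v0' (smooth_sigmaN d_gt0 o0 (fun _ h => h)) sv).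
have sR : smooth J (fun om => shiftR (v om)).
  apply: smooth_artanh => //.
    by move=> om _; rewrite st_lt1// andbT (lt_trans _ (st_gt0 p_gt1 _))// ltrN10.
  apply: smooth_sqrt => // [om _|]; first exact: sigma_gt0.
  exact: (smooth_comp oJ o0 v0' (smooth_sigma d_gt0 o0 (fun _ h => h)) sv).
pose a := edge_shift (fun om => shiftL (v om)) (fun om => shiftR (v om)).
have sa j : smooth J (a j) by rewrite /a /edge_shift; case: ifP.
pose e (j : 'I_N) := PC (fun om => cos (t * om) * amp om).
pose f (j : 'I_N) := PC (fun om => sin (t * om) * amp om).
have st' : smooth J (fun om => t * om) by apply: smoothM.
have se : gsmooth J e by move=> j /=; apply: smoothM => //; exact: smooth_cos.
have sf : gsmooth J f by move=> j /=; apply: smoothM => //; exact: smooth_sin.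
have vc c : vertex_cond L beta Z wid a J (fun=> PC c).
  apply: (@vertex_cond_balanced _ _ _ _ _ id) => om Jom.
  by split; [apply: balanced_st; exact: Fv|].
exists (gder L beta wid a e f), (gder1 L beta wid a e f), (gder2 L beta wid a e f).
split; first by move=> om Jom; apply: (@phase_Theta (fun om => t * om) _ _ _ id).
move=> k om Jom; split.
  exact: (gder_dom beta_gt0 oJ swid sa wid0 se sf (vc _) (vc _) k Jom).
exact: (gder_quotient L beta_gt0 oJ swid sa wid0 se sf k Jom).
Qed.

Lemma standing_wave_st om v : 0 < om -> F v = - Z * Num.sqrt om ->
  standing_wave p Z L om (Theta N n p L om (shiftL v) (shiftR v)).
Proof.
move=> om0 Fv.
have oJ : open [set: R] by exact: openT.
have sc k : smooth [set: R] (fun=> k) by exact: smooth_cst.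
have wid0 : 0 < wid om by rewrite /wid mulr_gt0// sqrtr_gt0.
pose b := fun _ : R => wid om.
pose a := edge_shift (fun=> shiftL v) (fun=> shiftR v).
have sa j : smooth [set: R] (a j) by rewrite /a /edge_shift; case: ifP.
pose e (j : 'I_N) := PC (fun t => cos (om * t) * amp om).
pose f (j : 'I_N) := PC (fun t => sin (om * t) * amp om).
have st' : smooth [set: R] (fun t => om * t).
  by apply: smoothM => //; exact: smooth_id.
have se : gsmooth [set: R] e by move=> j /=; apply: smoothM => //; exact: smooth_cos.
have sf : gsmooth [set: R] f by move=> j /=; apply: smoothM => //; exact: smooth_sin.
have vc c : vertex_cond L beta Z b a [set: R] (fun=> PC c).
  apply: (@vertex_cond_balanced _ _ _ _ _ (fun=> om)) => s _.
  by split; [exact: balanced_st|].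
have UE t : gder L beta b a e f 0 t =
    phase (om * t) (Theta N n p L om (shiftL v) (shiftR v)).
  exact: (@phase_Theta (fun t => om * t) b (fun=> shiftL v) (fun=> shiftR v) (fun=> om)).
have dom i t : delta'_dom_with Z L (gder L beta b a e f i t)
    (gder1 L beta b a e f i t) (gder2 L beta b a e f i t).
  exact: (gder_dom beta_gt0 oJ (sc _) sa (fun _ _ => wid0) se sf (vc _) (vc _) i I).
split.
  (* Domain membership is read off at time 0, where the phase factor is 1. *)
  exists (gder1 L beta b a e f 0 0), (gder2 L beta b a e f 0 0).
  have := dom 0%N 0; rewrite UE; congr delta'_dom_with.
  apply/funext => j; apply/funext => x.
  by rewrite /phase /expi mulr0 cos0 sin0 mul1r.
have UE' : gder L beta b a e f 0 =
    fun t => phase (om * t) (Theta N n p L om (shiftL v) (shiftR v)).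
  by apply/funext.
rewrite -UE'.
exists (gder1 L beta b a e f 0), (gder2 L beta b a e f 0), (gder L beta b a e f 1).
split.
- by move=> t; exact: dom.
- move=> t; exact: (gder_continuous L beta_gt0 oJ (sc _) sa (fun _ _ => wid0) se sf 0 I).
- move=> t; split.
    move=> j; apply: (gfun_L2 L beta_gt0 (sc _) sa (fun _ _ => wid0) j _ _ I).
      exact: (gsmooth_Dt beta oJ (sc _) sa se).
    exact: (gsmooth_Dt beta oJ (sc _) sa sf).
  exact: (gfun_quotient L beta_gt0 oJ (sc _) sa (fun _ _ => wid0) se sf I).
move=> t j; apply: aeW => x _.
have dth : is_derive t 1 (fun t => om * t) om.
  apply: is_derive_eq (is_derive_mulf (is_derive_cstf om t) (is_derive_idf t)) _.
  by ring.
have dc : is_derive t 1 (fun t => cos (om * t) * amp om) (- om * (sin (om * t) * amp om)).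
  apply: is_derive_eq (is_derive_mulf (is_derive_compf (is_derive_cos _) dth)
    (is_derive_cstf (amp om) t)) _.
  by ring.
have ds : is_derive t 1 (fun t => sin (om * t) * amp om) (om * (cos (om * t) * amp om)).
  apply: is_derive_eq (is_derive_mulf (is_derive_compf (is_derive_sin _) dth)
    (is_derive_cstf (amp om) t)) _.
  by ring.
have da : is_derive t 1 (a j) 0.
  by rewrite /a /edge_shift; case: ifP => _; exact: is_derive_cstf.
have db : is_derive t 1 b 0 by exact: is_derive_cstf.
rewrite /delta'_op /gder /gder1 /gder2 /gfun /gDx /gDt.
rewrite [iter 1 _ _ _]/= [iter 1 _ _ _]/= [iter 0 _ _]/= [iter 0 _ _]/= /e /f.
rewrite !pfun_Dx2_PC !(pfun_Dt_PC _ db da dc) !(pfun_Dt_PC _ db da ds).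
rewrite /pfun [peval _ _ _ _ _ _]/= [peval _ _ _ _ _ _]/=.
move: (arg L b (a j) t x) => y.
have := stationary_equation y om0.
move: (sech_gt0 y); move: (sech y `^ beta) (powR_ge0 (sech y) beta) => S S0 _ eq.
have cm : cmod ((S * (cos (om * t) * amp om) +i* (S * (sin (om * t) * amp om)))%C) =
    amp om * S.
  rewrite /cmod /ComplexField.Normc.normc.
  have -> : (S * (cos (om * t) * amp om)) ^+ 2 + (S * (sin (om * t) * amp om)) ^+ 2 =
      (amp om * S) ^+ 2 * (cos (om * t) ^+ 2 + sin (om * t) ^+ 2) by ring.
  by rewrite cos2Dsin2 mulr1 sqrtr_sqr ger0_norm// mulr_ge0// powR_ge0.
rewrite cm; move: eq; set X := (amp om * S) `^ _; set Y := tanh y => eq.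
(* Real and imaginary parts are the stationary equation times the amplitude and the cosine or sine
   of om t. *)
apply/eqP; rewrite eq_complex /=; apply/andP; split; apply/eqP.
  transitivity (cos (om * t) * amp om * 0); last by rewrite mulr0.
  by rewrite -[in RHS]eq /b; ring.
transitivity (sin (om * t) * amp om * 0); last by rewrite mulr0.
by rewrite -[in RHS]eq /b; ring.
Qed.

End StandingWaves.

(** * The two curves of standing waves above the threshold frequency *)

Unset Implicit Arguments.

Theorem theorem8p1 (R : realType) (N n : nat) (L Z p tstar : R)
  (hL : 0 <= L) (hZ : Z < 0) (hN : (2 <= N)%N) (hp : 1 < p)
  (hn : (1 <= n <= N - 1)%N) (ht : decreasing_branch_end N n p tstar) :
  let omstar := alpha N n p tstar ^+ 2 / Z ^+ 2 in
  (exists a1 aN : R -> R,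
    (forall om, omstar < om ->
       [/\ exists aA aB, shift_pair p (a1 om) (aN om) aA aB,
           branch_eq N n p Z om (a1 om) (aN om),
           delta'_dom Z L (Theta N n p L om (a1 om) (aN om)),
           standing_wave p Z L om (Theta N n p L om (a1 om) (aN om)) &
           vertex_discontinuous L (Theta N n p L om (a1 om) (aN om))]) /\
    (forall t : R, smooth_curve Z L [set om | omstar < om]
       (fun om => phase (t * om) (Theta N n p L om (a1 om) (aN om))))) /\
  (exists a1 aN : R -> R,
    (forall om, omstar < om ->
       [/\ 0 < tanh (a1 om) < tstar,
           branch_eq N n p Z om (a1 om) (aN om),
           delta'_dom Z L (Theta N n p L om (a1 om) (aN om)),
           standing_wave p Z L om (Theta N n p L om (a1 om) (aN om)) &
           tanh (a1 om) <> tcrit p ->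
             (exists aA aB, shift_pair p (a1 om) (aN om) aA aB) /\
             vertex_discontinuous L (Theta N n p L om (a1 om) (aN om))]) /\
    (forall t : R,
       smooth_curve Z L [set om | omstar < om /\ tanh (a1 om) <> tcrit p]
         (fun om => phase (t * om) (Theta N n p L om (a1 om) (aN om))))).
Proof.
move=> omstar.
pose d : R := (p - 1) / 2.
have d0 : 0 < d by rewrite /d divr_gt0// subr_gt0.
have [n1 nN] := andP hn.
have n0 : 0 < n%:R :> R by rewrite ltr0n.
have m0 : 0 < (N - n)%:R :> R by rewrite ltr0n; lia.
pose F := bF d n%:R (N - n)%:R.
have [vs [tvs Fvs incr crit]] := branch_end_param hp ht.
have Fvs0 : 0 < F vs by exact: bF_gt0.
have Z2 : 0 < Z ^+ 2 by rewrite exprn_even_gt0//= lt_eqF.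
have omstar0 : 0 <= omstar by rewrite /omstar divr_ge0// ?sqr_ge0// ltW.
have om0 om : omstar < om -> 0 < om by exact: le_lt_trans.
pose y (om : R) : R := - Z * Num.sqrt om.
(* Both sides being nonnegative, the claim is the squared inequality, which is the threshold
   condition on [om]. *)
have ylarge om : omstar < om -> F vs < y om.
  move=> hom; have h0 := om0 _ hom.
  have y0 : 0 <= y om by rewrite /y mulr_ge0 ?sqrtr_ge0// oppr_ge0 ltW.
  rewrite -ltr_sqr ?nnegrE ?(ltW Fvs0)//.
  rewrite /y exprMn sqrrN sqr_sqrtr ?(ltW h0)//.
  by rewrite [ltRHS]mulrC -ltr_pdivrMr//; move: hom; rewrite /omstar Fvs.
have cy : continuous y.
  move=> x; apply: cvgM; first exact: cvg_cst.
  exact: sqrt_continuous.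
have sy (J : set R) : open J -> (forall om, J om -> omstar < om) -> smooth J y.
  move=> oJ hJ; apply: smoothM => //; first exact: smooth_cst.
  by apply: smooth_sqrt => //; [move=> om /hJ; exact: om0|exact: smooth_id].
split.
(* An inverse that avoids v = 0 keeps the two shifts distinct for every [om] above the threshold. *)
- have [g [gP sg]] := bF_inverse_nonzero d0 n0 m0 incr crit.
  pose v om := g (y om).
  have vF om : omstar < om -> F (v om) = - Z * Num.sqrt om.
    by move=> /ylarge /gP[].
  have v0 om : omstar < om -> v om <> 0 by move=> /ylarge /gP[].
  exists (fun om => shiftL p (v om)), (fun om => shiftR p (v om)); split.
    move=> om hom; have /eqP vn0 := v0 om hom.
    have sw := standing_wave_st L hp hn (om0 _ hom) (vF om hom).
    split.
    + exact: shift_pair_st.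
    + exact: (branch_eq_st hp (vF om hom)).
    + exact: sw.1.
    + exact: sw.
    + exact: (vertex_discontinuous_balanced hp hn (om0 _ hom)
        (balanced_st hp (vF om hom)) (tanh_shift_neq hp vn0)).
  move=> t.
  have oJ : open [set om | omstar < om] by exact: open_gt.
  have oF : open [set z | F vs < z] by exact: open_gt.
  have sv := smooth_comp oJ oF ylarge sg (sy _ oJ (fun _ h => h)).
  exact: (smooth_curve_st L hp hn t oJ om0 v0 sv vF).
(* Staying on the given branch, the curve may pass v = 0, which is tanh (a1 om) = tcrit p by [tv0];
   discontinuity and smoothness are claimed elsewhere. *)
- have [g [gP og sg]] := bF_inverse_right d0 n0 m0 incr.
  pose v om := g (y om).
  have vF om : omstar < om -> F (v om) = - Z * Num.sqrt om.
    by move=> /ylarge /gP[].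
  have tL om : tanh (shiftL p (v om)) = st p (- v om).
    exact: tanh_artanh_st.
  have tv0 om : tanh (shiftL p (v om)) <> tcrit p <-> v om <> 0.
    rewrite tL -(st0 hp); split => h e; apply: h.
      by rewrite e oppr0.
    by rewrite -[LHS]opprK (st_inj hp e) oppr0.
  exists (fun om => shiftL p (v om)), (fun om => shiftR p (v om)); split.
    move=> om hom.
    have sw := standing_wave_st L hp hn (om0 _ hom) (vF om hom).
    split.
    + rewrite tL st_gt0//= -tvs st_mono// ltrN2.
      by have [] := gP _ (ylarge _ hom).
    + exact: (branch_eq_st hp (vF om hom)).
    + exact: sw.1.
    + exact: sw.
    + move=> /tv0 /eqP vn0; split; first exact: shift_pair_st.
      exact: (vertex_discontinuous_balanced hp hn (om0 _ hom)
        (balanced_st hp (vF om hom)) (tanh_shift_neq hp vn0)).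
  move=> t; set J := [set om | _ /\ _].
  (* Openness of [J] follows by pulling back the open domain of smoothness of [g] along the
     continuous [y]. *)
  have JE : J = [set om | omstar < om] `&` (y @^-1` [set z | F vs < z /\ g z <> 0]).
    apply/seteqP; split => om /= [hom].
      by move=> /tv0 h; do 2?split => //; exact: ylarge.
    by move=> [_ h]; split => //; apply/tv0.
  have oJ : open J.
    rewrite JE; apply: openI; first exact: open_gt.
    by apply: open_comp => // x _; exact: cy.
  have Jo om : J om -> omstar < om by case.
  have JJ om : J om -> [set z | F vs < z /\ g z <> 0] (y om) by rewrite JE => -[].
  have sv := smooth_comp oJ og JJ sg (sy _ oJ Jo).
  have Jv0 om : J om -> v om <> 0 by move=> [_ /tv0].
  exact: (smooth_curve_st L hp hn t oJ (fun _ h => om0 _ (Jo _ h)) Jv0 sv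
    (fun _ h => vF _ (Jo _ h))).
Qed.
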